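(* Let $(X,\mathcal{O}_X)$ be a noetherian scheme with associated locally ringed poset $(\mathcal{C},\mathcal{O}_{\mathcal{C}})$. The specialization functor $S:\mathcal{M}(\mathcal{O}_X)\to PSh(\mathcal{O}_{\mathcal{C}})$ is fully faithful; i.e., if $\mathcal{F},\mathcal{H}$ are two coherent sheaves of $\mathcal{O}_X$-modules and $(\phi_x)_{x\in\mathcal{C}}$ is a morphism of presheaves from $S\mathcal{F}$ to $S\mathcal{H}$ in $PSh(\mathcal{O}_{\mathcal{C}})$, then there exists a unique morphism of coherent sheaves $\psi:\mathcal{F}\to\mathcal{H}$ inducing this family (that is, $\psi_x=\phi_x$ on stalks for every $x\in X$).
   Context: For a noetherian scheme $(X,\mathcal{O}_X)$, the associated locally ringed poset $(\mathcal{C},\mathcal{O}_{\mathcal{C}})$ is the set of points of $X$ with the specialization order $x\le y$ iff $y\in\overline{\{x\}}$, regarded as a small category with a unique morphism $x\to y$ whenever $x\le y$, together with the presheaf (contravariant functor) of local rings $\mathcal{O}_{\mathcal{C}}(x):=\mathcal{O}_{X,x}$, where for $x\le y$ the map $\mathcal{O}_{X,y}\to\mathcal{O}_{X,x}$ is the canonical localization homomorphism. $PSh(\mathcal{O}_{\mathcal{C}})$ is the category of presheaves (contravariant functors) of modules over $\mathcal{O}_{\mathcal{C}}$: an object $G$ consists of an $\mathcal{O}_{\mathcal{C}}(x)$-module $G(x)$ for each $x\in\mathcal{C}$ and, functorially for $x\le y$, additive maps $G(y)\to G(x)$ that are linear over $\mathcal{O}_{\mathcal{C}}(y)\to\mathcal{O}_{\mathcal{C}}(x)$;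 morphisms are families of $\mathcal{O}_{\mathcal{C}}(x)$-linear maps compatible with these transition maps. $\mathcal{M}(\mathcal{O}_X)$ is the category of coherent sheaves of $\mathcal{O}_X$-modules. The specialization functor $S:\mathcal{M}(\mathcal{O}_X)\to PSh(\mathcal{O}_{\mathcal{C}})$ sends a coherent sheaf $\mathcal{F}$ to the presheaf $x\mapsto\mathcal{F}_x$ (stalks), with transition maps for $x\le y$ the canonical localization maps $\mathcal{F}_y\to\mathcal{F}_x$, $s\mapsto s\otimes_{\mathcal{O}_{X,y}}1$; it sends a morphism of sheaves to the family of induced maps on stalks. *)

(* Defs.v *)
From HB Require Import structures.
From mathcomp Require Import all_boot all_order all_algebra.
From mathcomp Require Import all_classical topology.
From mathcomp Require Import ring.

Set Implicit Arguments.
Unset Strict Implicit.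
Unset Printing Implicit Defensive.

Import Order.TTheory GRing.Theory.
Local Open Scope classical_set_scope.
Local Open Scope ring_scope.
Local Open Scope quotient_scope.

(* All rings are commutative and possibly trivial (comPzRingType): the ring of
   sections over the empty open set is zero. *)

(* MathComp's idealr only covers proper ideals of non-trivial rings,
   and is thus not available for the rings of a sheaf. *)

Definition is_ideal (R : comPzRingType) (I : set R) : Prop :=
  [/\ I 0, forall a b, I a -> I b -> I (a + b) & forall r a, I a -> I (r * a)].

Definition prime_ideal (R : comPzRingType) (I : set R) : Prop :=
  [/\ is_ideal I, ~ I 1 & forall a b, I (a * b) -> I a \/ I b].

Definition maximal_ideal (R : comPzRingType) (I : set R) : Prop :=
  [/\ is_ideal I, I <> setT &
      forall J, is_ideal J -> I `<=` J -> J = I \/ J = setT].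

Definition local_ring (R : comPzRingType) : Prop :=
  exists! m : set R, maximal_ideal m.

Definition noetherian_ring (R : comPzRingType) : Prop :=
  forall I : set R, is_ideal I -> exists n (g : 'I_n -> R),
    I = [set a | exists c : 'I_n -> R, a = \sum_i c i * g i].

Record opens (X : topologicalType) := Opens {
  oset :> set X;
  oset_open : open oset }.

Definition opensT (X : topologicalType) : opens X := Opens openT.
Definition opensI (X : topologicalType) (U V : opens X) : opens X :=
  Opens (openI (oset_open U) (oset_open V)).

Lemma opensIl (X : topologicalType) (U V : opens X) : opensI U V `<=` U.
Proof. by move=> x []. Qed.
Lemma opensIr (X : topologicalType) (U V : opens X) : opensI U V `<=` V.
Proof. by move=> x []. Qed.

Definition opens_preim (X Y : topologicalType) (f : X -> Y)
    (fc : continuous f) (V : opens Y) : opens X :=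
  Opens (open_comp (fun x _ => fc x) (oset_open V)).

Record zpresheaf (X : topologicalType) := ZPresheaf {
  zsec : opens X -> zmodType;
  zres : forall U V : opens X, V `<=` U -> {additive zsec U -> zsec V};
  zres_id : forall (U : opens X) (UU : U `<=` U) s, zres UU s = s;
  zres_comp : forall (U V W : opens X) (VU : V `<=` U) (WV : W `<=` V)
    (WU : W `<=` U) s, zres WV (zres VU s) = zres WU s }.

Definition zpresheaf_is_sheaf (X : topologicalType) (P : zpresheaf X) : Prop :=
  forall (I : Type) (U : opens X) (V : I -> opens X)
    (VU : forall i, V i `<=` U) (cov : U `<=` \bigcup_i V i)
    (s : forall i, zsec P (V i)),
    (forall i j, zres P (@opensIl _ (V i) (V j)) (s i)
               = zres P (@opensIr _ (V i) (V j)) (s j)) ->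
    exists! t : zsec P U, forall i, zres P (VU i) t = s i.

Record germ_rep (X : topologicalType) (P : zpresheaf X) (x : X) := GermRep {
  gdom : opens X;
  gdom_in : oset gdom x;
  gsec : zsec P gdom }.

HB.instance Definition _ (X : topologicalType) (P : zpresheaf X) (x : X) :=
  gen_eqMixin (germ_rep P x).
HB.instance Definition _ (X : topologicalType) (P : zpresheaf X) (x : X) :=
  gen_choiceMixin (germ_rep P x).

Definition germ_eq (X : topologicalType) (P : zpresheaf X) (x : X)
    (r q : germ_rep P x) : bool :=
  `[< exists (W : opens X) (Wr : W `<=` gdom r) (Wq : W `<=` gdom q),
        oset W x /\ zres P Wr (gsec r) = zres P Wq (gsec q) >].

Section Stalk.
Variables (X : topologicalType) (P : zpresheaf X) (x : X).

Lemma germ_eq_refl : reflexive (@germ_eq X P x).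
Proof.
move=> r; apply/asboolP; exists (gdom r), (fun _ h => h), (fun _ h => h).
by split=> //; exact: gdom_in.
Qed.

Lemma germ_eq_sym : symmetric (@germ_eq X P x).
Proof.
by move=> r q; apply/asboolP/asboolP => -[W [Wr [Wq [Wx e]]]];
  exists W, Wq, Wr.
Qed.

Lemma germ_eq_trans : transitive (@germ_eq X P x).
Proof.
move=> q r t /asboolP[W [Wr [Wq [Wx e]]]] /asboolP[V [Vq [Vt [Vx e']]]].
apply/asboolP; exists (opensI W V).
have WVW : opensI W V `<=` W := @opensIl _ W V.
have WVV : opensI W V `<=` V := @opensIr _ W V.
have WVr := subset_trans WVW Wr; have WVq := subset_trans WVW Wq.
have WVt := subset_trans WVV Vt.
exists WVr, WVt; split; first by split.
by rewrite -(zres_comp Wr WVW) e (zres_comp Wq WVW WVq) -(zres_comp Vq WVV WVq)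
  e' (zres_comp Vt WVV WVt).
Qed.

Canonical germ_equiv := EquivRel (@germ_eq X P x)
  germ_eq_refl germ_eq_sym germ_eq_trans.

Definition stalk : Type := {eq_quot germ_equiv}.

HB.instance Definition _ := Choice.on stalk.
HB.instance Definition _ := EqQuotient.on stalk.

Definition germ (U : opens X) (Ux : oset U x) (s : zsec P U) : stalk :=
  \pi_stalk (GermRep Ux s).

Lemma germP (U V : opens X) (Ux : oset U x) (Vx : oset V x) s t :
  germ Ux s = germ Vx t <->
  exists (W : opens X) (WU : W `<=` U) (WV : W `<=` V),
    oset W x /\ zres P WU s = zres P WV t.
Proof. by split=> [/eqmodP/asboolP|h] //; apply/eqmodP/asboolP. Qed.

Lemma germ_res (U V : opens X) (Ux : oset U x) (Vx : oset V x) (VU : V `<=` U) s :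
  germ Vx (zres P VU s) = germ Ux s.
Proof.
apply/germP; exists V, (fun _ h => h), VU; split=> //.
exact: zres_id.
Qed.

Lemma germ_reprK (c : stalk) : germ (gdom_in (repr c)) (gsec (repr c)) = c.
Proof. by rewrite -[RHS]reprK /germ; case: (repr c). Qed.

Lemma germ_surj (c : stalk) :
  exists (U : opens X) (Ux : oset U x) (s : zsec P U), c = germ Ux s.
Proof.
by exists (gdom (repr c)), (gdom_in (repr c)), (gsec (repr c)); rewrite germ_reprK.
Qed.

End Stalk.

Lemma germ_surj2 (X : topologicalType) (P Q : zpresheaf X) (x : X)
    (c : stalk P x) (d : stalk Q x) :
  exists (U : opens X) (Ux : oset U x) (s : zsec P U) (t : zsec Q U),
    c = germ Ux s /\ d = germ Ux t.
Proof.
have [U [Ux [s ->]]] := germ_surj c; have [V [Vx [t ->]]] := germ_surj d.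
have UVU : opensI U V `<=` U := @opensIl _ U V.
have UVV : opensI U V `<=` V := @opensIr _ U V.
exists (opensI U V), (conj Ux Vx), (zres P UVU s), (zres Q UVV t).
by rewrite !germ_res.
Qed.

Lemma germ_surj3 (X : topologicalType) (P Q R : zpresheaf X) (x : X)
    (c : stalk P x) (d : stalk Q x) (e : stalk R x) :
  exists (U : opens X) (Ux : oset U x) (s : zsec P U) (t : zsec Q U) (u : zsec R U),
    [/\ c = germ Ux s, d = germ Ux t & e = germ Ux u].
Proof.
have [U [Ux [s [t [-> ->]]]]] := germ_surj2 c d.
have [V [Vx [u ->]]] := germ_surj e.
have UVU : opensI U V `<=` U := @opensIl _ U V.
have UVV : opensI U V `<=` V := @opensIr _ U V.
exists (opensI U V), (conj Ux Vx), (zres P UVU s), (zres Q UVU t), (zres R UVV u).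
by rewrite !germ_res.
Qed.

Section StalkOp.
Variables (X : topologicalType) (x : X).

Definition stalk_op1 (P Q : zpresheaf X) (f : forall U, zsec P U -> zsec Q U)
    (c : stalk P x) : stalk Q x :=
  germ (gdom_in (repr c)) (f _ (gsec (repr c))).

Lemma stalk_op1E (P Q : zpresheaf X) (f : forall U, zsec P U -> zsec Q U)
    (fN : forall (U V : opens X) (VU : V `<=` U) s,
       zres Q VU (f U s) = f V (zres P VU s))
    (U : opens X) (Ux : oset U x) s :
  stalk_op1 f (germ Ux s) = germ Ux (f U s).
Proof.
rewrite /stalk_op1; set c := germ Ux s.
have /germP[W [Wc [WU [Wx e]]]] := germ_reprK c.
by apply/germP; exists W, Wc, WU; rewrite !fN e.
Qed.

Definition stalk_op2 (P Q R : zpresheaf X)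
    (f : forall U, zsec P U -> zsec Q U -> zsec R U)
    (c : stalk P x) (d : stalk Q x) : stalk R x :=
  let r := repr c in let q := repr d in
  germ (conj (gdom_in r) (gdom_in q) : oset (opensI (gdom r) (gdom q)) x)
    (f _ (zres P (@opensIl _ (gdom r) (gdom q)) (gsec r))
         (zres Q (@opensIr _ (gdom r) (gdom q)) (gsec q))).

Lemma stalk_op2E (P Q R : zpresheaf X)
    (f : forall U, zsec P U -> zsec Q U -> zsec R U)
    (fN : forall (U V : opens X) (VU : V `<=` U) s t,
       zres R VU (f U s t) = f V (zres P VU s) (zres Q VU t))
    (U : opens X) (Ux : oset U x) s t :
  stalk_op2 f (germ Ux s) (germ Ux t) = germ Ux (f U s t).
Proof.
rewrite /stalk_op2; set c := germ Ux s; set d := germ Ux t.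
have /germP[W [Wc [WU [Wx e]]]] := germ_reprK c.
have /germP[V [Vd [VU [Vx e']]]] := germ_reprK d.
apply/germP; exists (opensI W V).
have sI : opensI W V `<=` opensI (gdom (repr c)) (gdom (repr d)).
  by move=> y [/Wc ? /Vd ?].
have sU : opensI W V `<=` U by move=> y [/WU].
have sW : opensI W V `<=` W by move=> y [].
have sV : opensI W V `<=` V by move=> y [].
exists sI, sU; split=> //; rewrite !fN; congr f.
- rewrite (zres_comp _ sI (subset_trans sW Wc)) -(zres_comp Wc sW) e.
  exact: zres_comp.
- rewrite (zres_comp _ sI (subset_trans sV Vd)) -(zres_comp Vd sV) e'.
  exact: zres_comp.
Qed.

End StalkOp.

Section StalkZmod.
Variables (X : topologicalType) (P : zpresheaf X) (x : X).

Let addf U (s t : zsec P U) := s + t.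
Let oppf U (s : zsec P U) := - s.
Let addfN (U V : opens X) (VU : V `<=` U) s t :
  zres P VU (addf s t) = addf (zres P VU s) (zres P VU t).
Proof. exact: raddfD. Qed.
Let oppfN (U V : opens X) (VU : V `<=` U) s :
  zres P VU (oppf s) = oppf (zres P VU s).
Proof. exact: raddfN. Qed.

Let zero : stalk P x := germ (I : oset (opensT X) x) 0.
Let opp : stalk P x -> stalk P x := stalk_op1 oppf.
Let add : stalk P x -> stalk P x -> stalk P x := stalk_op2 addf.

Let zeroE (U : opens X) (Ux : oset U x) : zero = germ Ux 0.
Proof.
rewrite /zero -(germ_res (I : oset (opensT X) x) Ux (fun _ _ => I)).
by rewrite raddf0.
Qed.

Fact stalk_addA : associative add.
Proof.
move=> c d e; have [U [Ux [s [t [u [-> -> ->]]]]]] := germ_surj3 c d e.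
by rewrite /add !(stalk_op2E addfN) /addf addrA.
Qed.

Fact stalk_addC : commutative add.
Proof.
move=> c d; have [U [Ux [s [t [-> ->]]]]] := germ_surj2 c d.
by rewrite /add !(stalk_op2E addfN) /addf addrC.
Qed.

Fact stalk_add0 : left_id zero add.
Proof.
move=> c; have [U [Ux [s ->]]] := germ_surj c.
by rewrite /add (zeroE Ux) (stalk_op2E addfN) /addf add0r.
Qed.

Fact stalk_addN : left_inverse zero opp add.
Proof.
move=> c; have [U [Ux [s ->]]] := germ_surj c.
by rewrite /add /opp (stalk_op1E oppfN) (stalk_op2E addfN) /addf /oppf addNr (zeroE Ux).
Qed.

HB.instance Definition _ := GRing.isZmodule.Build (stalk P x)
  stalk_addA stalk_addC stalk_add0 stalk_addN.

Lemma germ0 (U : opens X) (Ux : oset U x) : germ Ux (0 : zsec P U) = 0.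
Proof. by rewrite -zeroE. Qed.

Lemma germD (U : opens X) (Ux : oset U x) (s t : zsec P U) :
  germ Ux (s + t) = germ Ux s + germ Ux t.
Proof. by rewrite -(stalk_op2E addfN). Qed.

End StalkZmod.

(* Every open neighbourhood of y contains the generization x of y, so a germ at y
   is a germ at x.  On a scheme this is the localization map, and on the stalks of
   a coherent sheaf it is s |-> s (x) 1. *)
Lemma generize (X : topologicalType) (x y : X) (xy : closure [set x] y)
  (U : opens X) : oset U y -> oset U x.
Proof.
move=> Uy; have [z [/= -> //]] := xy U (open_nbhs_nbhs (conj (oset_open U) Uy)).
Qed.

Definition stalk_gen (X : topologicalType) (P : zpresheaf X) (x y : X)
    (xy : closure [set x] y) (c : stalk P y) : stalk P x :=
  germ (generize xy (gdom_in (repr c))) (gsec (repr c)).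

Lemma stalk_genE (X : topologicalType) (P : zpresheaf X) (x y : X)
    (xy : closure [set x] y) (U : opens X) (Uy : oset U y) (Ux : oset U x) s :
  stalk_gen xy (germ Uy s : stalk P y) = germ Ux s.
Proof.
rewrite /stalk_gen; set c := germ Uy s.
have /germP[W [Wc [WU [Wy e]]]] := germ_reprK c.
by apply/germP; exists W, Wc, WU; split=> //; exact: (generize xy Wy).
Qed.

Record rpresheaf (X : topologicalType) := RPresheaf {
  rsec :> opens X -> comPzRingType;
  rres : forall U V : opens X, V `<=` U -> {rmorphism rsec U -> rsec V};
  rres_id : forall (U : opens X) (UU : U `<=` U) s, rres UU s = s;
  rres_comp : forall (U V W : opens X) (VU : V `<=` U) (WV : W `<=` V)
    (WU : W `<=` U) s, rres WV (rres VU s) = rres WU s }.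

Definition rpresheaf_z (X : topologicalType) (O : rpresheaf X) : zpresheaf X :=
  ZPresheaf (zsec := fun U => O U)
    (zres := fun U V VU => rres O VU : {additive O U -> O V})
    (@rres_id X O) (@rres_comp X O).

Definition rstalk (X : topologicalType) (O : rpresheaf X) (x : X) : Type :=
  stalk (rpresheaf_z O) x.

HB.instance Definition _ (X : topologicalType) (O : rpresheaf X) (x : X) :=
  GRing.Zmodule.on (rstalk O x).

Section StalkRing.
Variables (X : topologicalType) (O : rpresheaf X) (x : X).
Notation P := (rpresheaf_z O).

Let mulf U (s t : zsec P U) : zsec P U := (s : O U) * (t : O U).
Let mulfN (U V : opens X) (VU : V `<=` U) s t :
  zres P VU (mulf s t) = mulf (zres P VU s) (zres P VU t).
Proof. exact: rmorphM. Qed.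

Let one : rstalk O x := @germ _ P _ _ (I : oset (opensT X) x) (1 : O _).
Let mul : rstalk O x -> rstalk O x -> rstalk O x := stalk_op2 mulf.

Let oneE (U : opens X) (Ux : oset U x) : one = @germ _ P _ _ Ux (1 : O U).
Proof.
rewrite /one -(@germ_res _ P _ _ _ (I : oset (opensT X) x) Ux (fun _ _ => I)).
by congr germ; exact: rmorph1.
Qed.

Fact rstalk_mulA : associative mul.
Proof.
move=> c d e; have [U [Ux [s [t [u [-> -> ->]]]]]] := germ_surj3 c d e.
by rewrite /mul !(stalk_op2E mulfN) /mulf mulrA.
Qed.

Fact rstalk_mulC : commutative mul.
Proof.
move=> c d; have [U [Ux [s [t [-> ->]]]]] := germ_surj2 c d.
by rewrite /mul !(stalk_op2E mulfN) /mulf mulrC.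
Qed.

Fact rstalk_mul1 : left_id one mul.
Proof.
move=> c; have [U [Ux [s ->]]] := germ_surj c.
by rewrite /mul (oneE Ux) (stalk_op2E mulfN) /mulf mul1r.
Qed.

Fact rstalk_mulD : left_distributive mul +%R.
Proof.
move=> c d e; have [U [Ux [s [t [u [-> -> ->]]]]]] := germ_surj3 c d e.
by rewrite -germD /mul !(stalk_op2E mulfN) -germD /mulf mulrDl.
Qed.

HB.instance Definition _ := GRing.Zmodule_isComPzRing.Build (rstalk O x)
  rstalk_mulA rstalk_mulC rstalk_mul1 rstalk_mulD.

Definition rgerm (U : opens X) (Ux : oset U x) (s : O U) : rstalk O x :=
  @germ _ P _ _ Ux s.

Lemma rgerm1 (U : opens X) (Ux : oset U x) : rgerm Ux (1 : O U) = 1.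
Proof. by rewrite /rgerm -oneE. Qed.

Lemma rgermM (U : opens X) (Ux : oset U x) (s t : O U) :
  rgerm Ux (s * t) = rgerm Ux s * rgerm Ux t.
Proof. by rewrite /rgerm -(stalk_op2E mulfN). Qed.

End StalkRing.

Definition rstalk_gen (X : topologicalType) (O : rpresheaf X) (x y : X)
    (xy : closure [set x] y) : rstalk O y -> rstalk O x :=
  @stalk_gen X (rpresheaf_z O) x y xy.

Section RStalkGen.
Variables (X : topologicalType) (O : rpresheaf X) (x y : X).
Variable xy : closure [set x] y.

Lemma rstalk_genE (U : opens X) (Uy : oset U y) (Ux : oset U x) (s : O U) :
  rstalk_gen xy (rgerm Uy s) = rgerm Ux s.
Proof. exact: stalk_genE. Qed.

Fact rstalk_gen_zmod_morphism : zmod_morphism (@rstalk_gen X O x y xy).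
Proof.
move=> c d; have [U [Uy [s [t [-> ->]]]]] := germ_surj2 c d.
have Ux := generize xy Uy; apply: (canRL (addrK _)).
rewrite -!/(rgerm _ _).
rewrite !(rstalk_genE Uy Ux).
have -> : rgerm Uy s - rgerm Uy t = rgerm Uy (s - t : O U).
  by apply: (canLR (addrK _)); rewrite -[LHS]/(germ Uy _) -germD subrK.
by rewrite (rstalk_genE Uy Ux) -[LHS]/(germ Ux _ + germ Ux _) -germD subrK.
Qed.

Fact rstalk_gen_monoid_morphism : monoid_morphism (@rstalk_gen X O x y xy).
Proof.
split.
  rewrite -(rgerm1 O (I : oset (opensT X) y)).
  by rewrite (rstalk_genE _ (I : oset (opensT X) x)) rgerm1.
move=> c d; have [U [Uy [s [t [-> ->]]]]] := germ_surj2 c d.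
have Ux := generize xy Uy; rewrite -!/(rgerm _ _) -rgermM.
by rewrite !(rstalk_genE Uy Ux) rgermM.
Qed.

HB.instance Definition _ := GRing.isZmodMorphism.Build (rstalk O y) (rstalk O x)
  (@rstalk_gen X O x y xy) rstalk_gen_zmod_morphism.
HB.instance Definition _ := GRing.isMonoidMorphism.Build (rstalk O y) (rstalk O x)
  (@rstalk_gen X O x y xy) rstalk_gen_monoid_morphism.

End RStalkGen.

Record ringed_space := RingedSpace {
  rs_pt :> topologicalType;
  rs_O : rpresheaf rs_pt;
  rs_sheaf : zpresheaf_is_sheaf (rpresheaf_z rs_O) }.

Record rs_hom (X Y : ringed_space) := RsHom {
  rs_map :> X -> Y;
  rs_cont : continuous rs_map;
  rs_sharp : forall V : opens Y,
    {rmorphism rs_O Y V -> rs_O X (opens_preim rs_cont V)};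
  rs_nat : forall (U V : opens Y) (VU : V `<=` U)
    (VU' : opens_preim rs_cont V `<=` opens_preim rs_cont U) (s : rs_O Y U),
    rres (rs_O X) VU' (rs_sharp U s) = rs_sharp V (rres (rs_O Y) VU s) }.

(* An isomorphism of X onto an open subspace of Y.  It induces isomorphisms on
   stalks, so between locally ringed spaces it is automatically a morphism of
   locally ringed spaces. *)
Definition open_immersion (X Y : ringed_space) (f : rs_hom X Y) : Prop :=
  [/\ injective f,
      forall U : set X, open U -> open (f @` U) &
      forall V : opens Y, V `<=` range f -> bijective (rs_sharp f V)].

Record spec (A : comPzRingType) := SpecPt {
  spec_ideal :> set A;
  spec_prime : prime_ideal spec_ideal }.

HB.instance Definition _ (A : comPzRingType) := gen_eqMixin (spec A).
HB.instance Definition _ (A : comPzRingType) := gen_choiceMixin (spec A).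

Section SpecTopology.
Variable A : comPzRingType.

Lemma spec_eq (p q : spec A) : spec_ideal p = spec_ideal q -> p = q.
Proof.
case: p q => [p pP] [q qP] /= e; rewrite -{}e in qP *.
by rewrite (Prop_irrelevance pP qP).
Qed.

Definition spec_open : set (set (spec A)) :=
  [set U | exists E : set A, U = [set p : spec A | ~ (E `<=` spec_ideal p)]].

Fact spec_openT : spec_open setT.
Proof.
exists setT; apply/esym/seteqP; split=> // p _ h.
by case: (spec_prime p) => _ + _; apply; exact: h.
Qed.

Fact spec_openI : setI_closed spec_open.
Proof.
move=> _ _ [E ->] [F ->].
exists [set c | exists a b, [/\ E a, F b & c = a * b]].
apply/seteqP; split=> p /=.
  move=> [/existsNP[a /not_implyP[Ea pa]] /existsNP[b /not_implyP[Fb pb]]] h.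
  have [_ _ pM] := spec_prime p.
  by have /pM[] : spec_ideal p (a * b) by apply: h; exists a, b.
have [[_ _ pZ] _ _] := spec_prime p.
move=> h; split=> h'; apply: h => c [a [b [Ea Fb ->]]].
  by rewrite mulrC; apply: pZ; exact: h'.
by apply: pZ; exact: h'.
Qed.

Fact spec_open_bigU (I : Type) (f : I -> set (spec A)) :
  (forall i, spec_open (f i)) -> spec_open (\bigcup_i f i).
Proof.
move=> /choice[E fE]; exists (\bigcup_i E i); apply/seteqP; split=> p /=.
  move=> [i _]; rewrite fE => /= h h'; apply: h => a Ea; apply: h'.
  by exists i.
move=> /existsNP[a /not_implyP[[i _ Ea] pa]]; exists i => //.
by rewrite fE => h; apply: pa; exact: h.
Qed.

HB.instance Definition _ := isOpenTopological.Build (spec A)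
  spec_openT spec_openI spec_open_bigU.

End SpecTopology.

(* Localization of A at the prime p: pairs (a, s) with s outside p stand for the
   fraction a / s. *)
Section Localization.
Variables (A : comPzRingType) (p : spec A).

Record frac_rep := FracRep {
  fnum : A;
  fden : A;
  fdenP : ~ spec_ideal p fden }.

HB.instance Definition _ := gen_eqMixin frac_rep.
HB.instance Definition _ := gen_choiceMixin frac_rep.

Definition frac_eq (r q : frac_rep) : bool :=
  `[< exists u, ~ spec_ideal p u /\
        u * (fnum r * fden q) = u * (fnum q * fden r) >].

Lemma notin_mul (s t : A) :
  ~ spec_ideal p s -> ~ spec_ideal p t -> ~ spec_ideal p (s * t).
Proof. by move=> ps pt; have [_ _ h] := spec_prime p; case/h. Qed.

Lemma notin_1 : ~ spec_ideal p 1.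
Proof. by have [] := spec_prime p. Qed.

Fact frac_eq_refl : reflexive frac_eq.
Proof. by move=> r; apply/asboolP; exists 1; split=> //; exact: notin_1. Qed.

Fact frac_eq_sym : symmetric frac_eq.
Proof. by move=> r q; apply/asboolP/asboolP => -[u [pu e]]; exists u. Qed.

Fact frac_eq_trans : transitive frac_eq.
Proof.
move=> [b t pt] [a s ps] [c w pw] /asboolP[u [pu /= e]] /asboolP[v [pv /= e']].
apply/asboolP; exists (u * v * t); split; first by do !apply: notin_mul.
have -> : u * v * t * (a * w) = v * w * (u * (a * t)) by ring.
have -> : u * v * t * (c * s) = u * s * (v * (c * t)) by ring.
by rewrite e -e'; ring.
Qed.

Canonical frac_equiv := EquivRel frac_eq frac_eq_refl frac_eq_sym frac_eq_trans.

Definition localization : Type := {eq_quot frac_equiv}.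

HB.instance Definition _ := Choice.on localization.
HB.instance Definition _ := EqQuotient.on localization.

Definition frac (a s : A) (ps : ~ spec_ideal p s) : localization :=
  \pi_localization (FracRep a ps).

Lemma fracP a s (ps : ~ spec_ideal p s) b t (pt : ~ spec_ideal p t) :
  frac a ps = frac b pt <->
  exists u, ~ spec_ideal p u /\ u * (a * t) = u * (b * s).
Proof. by split=> [/eqmodP/asboolP|h] //; apply/eqmodP/asboolP. Qed.

Lemma frac_eq1 a s (ps : ~ spec_ideal p s) b t (pt : ~ spec_ideal p t) :
  a * t = b * s -> frac a ps = frac b pt.
Proof. by move=> e; apply/fracP; exists 1; rewrite e; split=> //; exact: notin_1. Qed.

Lemma frac_reprK (c : localization) : frac (fnum (repr c)) (@fdenP (repr c)) = c.
Proof. by rewrite -[RHS]reprK /frac; case: (repr c). Qed.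

Lemma frac_surj (c : localization) :
  exists a s (ps : ~ spec_ideal p s), c = frac a ps.
Proof.
by exists (fnum (repr c)), (fden (repr c)), (@fdenP (repr c)); rewrite frac_reprK.
Qed.

Let add (c d : localization) : localization :=
  frac (fnum (repr c) * fden (repr d) + fnum (repr d) * fden (repr c))
    (notin_mul (@fdenP (repr c)) (@fdenP (repr d))).
Let mul (c d : localization) : localization :=
  frac (fnum (repr c) * fnum (repr d))
    (notin_mul (@fdenP (repr c)) (@fdenP (repr d))).
Let opp (c : localization) : localization :=
  frac (- fnum (repr c)) (@fdenP (repr c)).

Let addE a s (ps : ~ spec_ideal p s) b t (pt : ~ spec_ideal p t) :
  add (frac a ps) (frac b pt) = frac (a * t + b * s) (notin_mul ps pt).
Proof.
rewrite /add; set c := frac a ps; set d := frac b pt.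
have /fracP[u [pu e]] := frac_reprK c; have /fracP[v [pv e']] := frac_reprK d.
case: (repr c) (repr d) e e' => [a' s' ps'] [b' t' pt'] /= e e'.
apply/fracP; exists (u * v); split; first exact: notin_mul.
transitivity (v * t * t' * (u * (a' * s)) + u * s * s' * (v * (b' * t))); first by ring.
by rewrite e e'; ring.
Qed.

Let mulE a s (ps : ~ spec_ideal p s) b t (pt : ~ spec_ideal p t) :
  mul (frac a ps) (frac b pt) = frac (a * b) (notin_mul ps pt).
Proof.
rewrite /mul; set c := frac a ps; set d := frac b pt.
have /fracP[u [pu e]] := frac_reprK c; have /fracP[v [pv e']] := frac_reprK d.
case: (repr c) (repr d) e e' => [a' s' ps'] [b' t' pt'] /= e e'.
apply/fracP; exists (u * v); split; first exact: notin_mul.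
transitivity ((u * (a' * s)) * (v * (b' * t))); first by ring.
by rewrite e e'; ring.
Qed.

Let oppE a s (ps : ~ spec_ideal p s) : opp (frac a ps) = frac (- a) ps.
Proof.
rewrite /opp; set c := frac a ps.
have /fracP[u [pu e]] := frac_reprK c.
by apply/fracP; exists u; split=> //; rewrite !mulNr !mulrN e.
Qed.

Let zero := frac 0 notin_1.
Let one := frac 1 notin_1.

Fact localization_addA : associative add.
Proof.
move=> c d e; have [a [s [ps ->]]] := frac_surj c.
have [b [t [pt ->]]] := frac_surj d; have [a' [s' [ps' ->]]] := frac_surj e.
by rewrite !addE; apply: frac_eq1; ring.
Qed.

Fact localization_addC : commutative add.
Proof.
move=> c d; have [a [s [ps ->]]] := frac_surj c.
have [b [t [pt ->]]] := frac_surj d.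
by rewrite !addE; apply: frac_eq1; ring.
Qed.

Fact localization_add0 : left_id zero add.
Proof.
move=> c; have [a [s [ps ->]]] := frac_surj c.
by rewrite !addE; apply: frac_eq1; ring.
Qed.

Fact localization_addN : left_inverse zero opp add.
Proof.
move=> c; have [a [s [ps ->]]] := frac_surj c.
by rewrite oppE addE; apply: frac_eq1; ring.
Qed.

HB.instance Definition _ := GRing.isZmodule.Build localization
  localization_addA localization_addC localization_add0 localization_addN.

Fact localization_mulA : associative mul.
Proof.
move=> c d e; have [a [s [ps ->]]] := frac_surj c.
have [b [t [pt ->]]] := frac_surj d; have [a' [s' [ps' ->]]] := frac_surj e.
by rewrite !mulE; apply: frac_eq1; ring.
Qed.

Fact localization_mulC : commutative mul.
Proof.
move=> c d; have [a [s [ps ->]]] := frac_surj c.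
have [b [t [pt ->]]] := frac_surj d.
by rewrite !mulE; apply: frac_eq1; ring.
Qed.

Fact localization_mul1 : left_id one mul.
Proof.
move=> c; have [a [s [ps ->]]] := frac_surj c.
by rewrite !mulE; apply: frac_eq1; ring.
Qed.

Fact localization_mulD : left_distributive mul +%R.
Proof.
move=> c d e; have [a [s [ps ->]]] := frac_surj c.
have [b [t [pt ->]]] := frac_surj d; have [a' [s' [ps' ->]]] := frac_surj e.
rewrite -[_ + frac b pt]/(add _ _) -[RHS]/(add _ _).
by rewrite !(addE, mulE); apply: frac_eq1; ring.
Qed.

HB.instance Definition _ := GRing.Zmodule_isComPzRing.Build localization
  localization_mulA localization_mulC localization_mul1 localization_mulD.

Lemma fracD a s (ps : ~ spec_ideal p s) b t (pt : ~ spec_ideal p t) :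
  frac a ps + frac b pt = frac (a * t + b * s) (notin_mul ps pt).
Proof. exact: addE. Qed.

Lemma fracM a s (ps : ~ spec_ideal p s) b t (pt : ~ spec_ideal p t) :
  frac a ps * frac b pt = frac (a * b) (notin_mul ps pt).
Proof. exact: mulE. Qed.

Lemma fracN a s (ps : ~ spec_ideal p s) : - frac a ps = frac (- a) ps.
Proof. exact: oppE. Qed.

Lemma frac0 : frac 0 notin_1 = 0.
Proof. by []. Qed.

Lemma frac1 : frac 1 notin_1 = 1.
Proof. by []. Qed.

End Localization.

(* Sections over U of the structure sheaf of Spec A: families of elements of the local
   rings at the points of U which are locally given by a fraction a / b. *)
Section SpecSheaf.
Variable A : comPzRingType.

Definition locally_frac (U : opens (spec A))
    (s : forall p : spec A, oset U p -> localization p) : Prop :=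
  forall p, oset U p -> exists (V : opens (spec A)) (VU : V `<=` U) (a b : A),
    oset V p /\ forall q (Vq : oset V q),
      exists qb : ~ spec_ideal q b, s q (VU q Vq) = frac a qb.

Record spec_sec (U : opens (spec A)) := SpecSec {
  sval_at :> forall p : spec A, oset U p -> localization p;
  sval_frac : locally_frac sval_at }.

HB.instance Definition _ U := gen_eqMixin (spec_sec U).
HB.instance Definition _ U := gen_choiceMixin (spec_sec U).

Lemma spec_sec_eq U (s t : spec_sec U) :
  (forall p (Up : oset U p), s p Up = t p Up) -> s = t.
Proof.
case: s t => [s sP] [t tP] /= e.
have {}e : s = t by apply: functional_extensionality_dep => p;
  apply: functional_extensionality_dep => Up; exact: e.
by rewrite -{}e in tP *; rewrite (Prop_irrelevance sP tP).
Qed.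

Section Ops.
Variable U : opens (spec A).

Fact spec_cst_frac (a : A) : @locally_frac U (fun p _ => frac a (@notin_1 A p)).
Proof.
move=> p Up; exists U, (fun _ h => h), a, 1; split=> // q _.
by exists (@notin_1 A q).
Qed.

Fact spec_add_frac (s t : spec_sec U) :
  @locally_frac U (fun p Up => s p Up + t p Up).
Proof.
move=> p Up; have [V [VU [a [b [Vp sV]]]]] := sval_frac s Up.
have [W [WU [c [d [Wp tW]]]]] := sval_frac t Up.
exists (opensI V W), (subset_trans (@opensIl _ V W) VU), (a * d + c * b), (b * d).
split=> // q [Vq Wq]; have [qb sE] := sV q Vq; have [qd tE] := tW q Wq.
exists (notin_mul qb qd); rewrite -fracD -sE -tE.
by congr (s q _ + t q _); exact: Prop_irrelevance.
Qed.

Fact spec_mul_frac (s t : spec_sec U) :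
  @locally_frac U (fun p Up => s p Up * t p Up).
Proof.
move=> p Up; have [V [VU [a [b [Vp sV]]]]] := sval_frac s Up.
have [W [WU [c [d [Wp tW]]]]] := sval_frac t Up.
exists (opensI V W), (subset_trans (@opensIl _ V W) VU), (a * c), (b * d).
split=> // q [Vq Wq]; have [qb sE] := sV q Vq; have [qd tE] := tW q Wq.
exists (notin_mul qb qd); rewrite -fracM -sE -tE.
by congr (s q _ * t q _); exact: Prop_irrelevance.
Qed.

Fact spec_opp_frac (s : spec_sec U) : @locally_frac U (fun p Up => - s p Up).
Proof.
move=> p Up; have [V [VU [a [b [Vp sV]]]]] := sval_frac s Up.
exists V, VU, (- a), b; split=> // q Vq; have [qb sE] := sV q Vq.
by exists qb; rewrite -fracN -sE.
Qed.

Let cst a := SpecSec (spec_cst_frac a).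
Let add s t := SpecSec (spec_add_frac s t).
Let mul s t := SpecSec (spec_mul_frac s t).
Let opp s := SpecSec (spec_opp_frac s).

Fact spec_addA : associative add.
Proof. by move=> s t u; apply: spec_sec_eq => p Up /=; rewrite addrA. Qed.
Fact spec_addC : commutative add.
Proof. by move=> s t; apply: spec_sec_eq => p Up /=; rewrite addrC. Qed.
Fact spec_add0 : left_id (cst 0) add.
Proof. by move=> s; apply: spec_sec_eq => p Up /=; rewrite frac0 add0r. Qed.
Fact spec_addN : left_inverse (cst 0) opp add.
Proof. by move=> s; apply: spec_sec_eq => p Up /=; rewrite frac0 addNr. Qed.

HB.instance Definition _ := GRing.isZmodule.Build (spec_sec U)
  spec_addA spec_addC spec_add0 spec_addN.

Fact spec_mulA : associative mul.
Proof. by move=> s t u; apply: spec_sec_eq => p Up /=; rewrite mulrA. Qed.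
Fact spec_mulC : commutative mul.
Proof. by move=> s t; apply: spec_sec_eq => p Up /=; rewrite mulrC. Qed.
Fact spec_mul1 : left_id (cst 1) mul.
Proof. by move=> s; apply: spec_sec_eq => p Up /=; rewrite frac1 mul1r. Qed.
Fact spec_mulD : left_distributive mul +%R.
Proof. by move=> s t u; apply: spec_sec_eq => p Up /=; rewrite mulrDl. Qed.

HB.instance Definition _ := GRing.Zmodule_isComPzRing.Build (spec_sec U)
  spec_mulA spec_mulC spec_mul1 spec_mulD.

End Ops.

Section Res.
Variables (U V : opens (spec A)) (VU : V `<=` U).

Fact spec_res_frac (s : spec_sec U) :
  @locally_frac V (fun p Vp => s p (VU Vp)).
Proof.
move=> p Vp; have [W [WU [a [b [Wp sW]]]]] := sval_frac s (VU Vp).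
exists (opensI W V), (@opensIr _ W V), a, b; split=> // q [Wq Vq].
have [qb sE] := sW q Wq; exists qb; rewrite -sE.
by congr (s q _); exact: Prop_irrelevance.
Qed.

Definition spec_res (s : spec_sec U) : spec_sec V := SpecSec (spec_res_frac s).

Fact spec_res_zmod_morphism : zmod_morphism spec_res.
Proof. by move=> s t; apply: spec_sec_eq. Qed.
Fact spec_res_monoid_morphism : monoid_morphism spec_res.
Proof. by split=> [|s t]; apply: spec_sec_eq. Qed.

HB.instance Definition _ := GRing.isZmodMorphism.Build (spec_sec U) (spec_sec V)
  spec_res spec_res_zmod_morphism.
HB.instance Definition _ := GRing.isMonoidMorphism.Build (spec_sec U) (spec_sec V)
  spec_res spec_res_monoid_morphism.

End Res.

Fact spec_res_id (U : opens (spec A)) (UU : U `<=` U) (s : spec_sec U) :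
  spec_res UU s = s.
Proof.
by apply: spec_sec_eq => p Up /=; congr (s p _); exact: Prop_irrelevance.
Qed.

Fact spec_res_comp (U V W : opens (spec A)) (VU : V `<=` U) (WV : W `<=` V)
  (WU : W `<=` U) (s : spec_sec U) : spec_res WV (spec_res VU s) = spec_res WU s.
Proof.
by apply: spec_sec_eq => p Up /=; congr (s p _); exact: Prop_irrelevance.
Qed.

Definition spec_O : rpresheaf (spec A) :=
  RPresheaf (rsec := fun U => spec_sec U)
    (rres := fun U V VU => spec_res VU : {rmorphism spec_sec U -> spec_sec V})
    spec_res_id spec_res_comp.

Lemma spec_is_sheaf : zpresheaf_is_sheaf (rpresheaf_z spec_O).
Proof.
move=> I U V VU cov s sE.
have idx p : oset U p -> {i | oset (V i) p}.
  by move=> Up; apply: cid; have [i _ Vp] := cov p Up; exists i.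
have sval i j p (Vi : oset (V i) p) (Vj : oset (V j) p) :
    (s i : spec_sec _) p Vi = (s j : spec_sec _) p Vj.
  have Vij : oset (opensI (V i) (V j)) p by split.
  have := congr1 (fun t : spec_sec _ => t p Vij) (sE i j).
  by rewrite /= (Prop_irrelevance (opensIl _) Vi) (Prop_irrelevance (opensIr _) Vj).
pose t0 p (Up : oset U p) : localization p :=
  (s (projT1 (idx p Up)) : spec_sec _) p (projT2 (idx p Up)).
have t0E i p Up Vp : t0 p Up = (s i : spec_sec _) p Vp by exact: sval.
have t0P : locally_frac t0.
  move=> p Up; have [i _ Vp] := cov p Up.
  have [W [WV [a [b [Wp sW]]]]] := sval_frac (s i : spec_sec _) Vp.
  exists W, (subset_trans WV (VU i)), a, b; split=> // q Wq.
  have [qb E] := sW q Wq; exists qb.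
  by rewrite (t0E i q _ (WV q Wq)).
exists (SpecSec t0P : spec_sec U); split.
  by move=> i; apply: spec_sec_eq => p Vp /=; exact: t0E.
move=> t tE; apply: spec_sec_eq => p Up /=; have [i _ Vp] := cov p Up.
rewrite (t0E i p Up Vp) -tE /=.
by congr ((t : spec_sec U) p _); exact: Prop_irrelevance.
Qed.

Definition Spec : ringed_space := RingedSpace spec_is_sheaf.

End SpecSheaf.

Record scheme := Scheme {
  sch_space :> ringed_space;
  sch_local : forall x : sch_space, local_ring (rstalk (rs_O sch_space) x);
  sch_affine : forall x : sch_space, exists (A : comPzRingType)
    (f : rs_hom (Spec A) sch_space), open_immersion f /\ range f x }.

Definition locally_noetherian (X : scheme) : Prop :=
  forall x : X, exists (A : comPzRingType) (f : rs_hom (Spec A) X),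
    [/\ noetherian_ring A, open_immersion f & range f x].

Definition noetherian_scheme (X : scheme) : Prop :=
  locally_noetherian X /\ compact [set: X].

Lemma linear_ext (R : pzRingType) (U V : lmodType R) (f g : {linear U -> V}) :
  f =1 g -> f = g.
Proof.
case: f g => [f [[fD] [fZ]]] [g [[gD] [gZ]]] /= /funext e.
rewrite -{}e in gD gZ *.
by rewrite (Prop_irrelevance fD gD) (Prop_irrelevance fZ gZ).
Qed.

Record mpresheaf (X : topologicalType) (O : rpresheaf X) := MPresheaf {
  msec :> forall U : opens X, lmodType (O U);
  mres : forall U V : opens X, forall VU : V `<=` U,
    {linear msec U -> msec V | rres O VU \; *:%R};
  mres_id : forall (U : opens X) (UU : U `<=` U) s, mres UU s = s;
  mres_comp : forall (U V W : opens X) (VU : V `<=` U) (WV : W `<=` V)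
    (WU : W `<=` U) s, mres WV (mres VU s) = mres WU s }.

Record mhom (X : topologicalType) (O : rpresheaf X) (F H : mpresheaf O) := MHom {
  mh_fun :> forall U : opens X, {linear F U -> H U};
  mh_nat : forall (U V : opens X) (VU : V `<=` U) (s : F U),
    mres H VU (mh_fun U s) = mh_fun V (mres F VU s) }.

Section Mhom.
Variables (X : topologicalType) (O : rpresheaf X).

Lemma mhom_ext (F H : mpresheaf O) (f g : mhom F H) :
  (forall U s, f U s = g U s) -> f = g.
Proof.
case: f g => [f fN] [g gN] /= e.
have {}e : f = g.
  by apply: functional_extensionality_dep => U; apply: linear_ext; exact: e.
by rewrite -{}e in gN *; rewrite (Prop_irrelevance fN gN).
Qed.

Definition mhom_id (F : mpresheaf O) : mhom F F :=
  @MHom X O F F (fun U => idfun) (fun _ _ _ _ => erefl).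

Fact mhom_comp_nat (F G H : mpresheaf O) (g : mhom G H) (f : mhom F G)
    (U V : opens X) (VU : V `<=` U) (s : F U) :
  mres H VU ((g U \o f U) s) = (g V \o f V) (mres F VU s).
Proof. by rewrite /= !mh_nat. Qed.

Definition mhom_comp (F G H : mpresheaf O) (g : mhom G H) (f : mhom F G) :
  mhom F H := @MHom X O F H (fun U => g U \o f U) (mhom_comp_nat g f).

Definition mpresheaf_z (F : mpresheaf O) : zpresheaf X :=
  ZPresheaf (zsec := fun U => F U)
    (zres := fun U V VU => mres F VU : {additive F U -> F V})
    (@mres_id X O F) (@mres_comp X O F).

Definition mpresheaf_is_sheaf (F : mpresheaf O) : Prop :=
  zpresheaf_is_sheaf (mpresheaf_z F).

End Mhom.

Definition mstalk (X : topologicalType) (O : rpresheaf X) (F : mpresheaf O)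
  (x : X) : Type := stalk (mpresheaf_z F) x.

HB.instance Definition _ (X : topologicalType) (O : rpresheaf X)
  (F : mpresheaf O) (x : X) := GRing.Zmodule.on (mstalk F x).

Section StalkMod.
Variables (X : topologicalType) (O : rpresheaf X) (F : mpresheaf O) (x : X).
Notation P := (rpresheaf_z O).
Notation Q := (mpresheaf_z F).

Let scalef U (a : zsec P U) (s : zsec Q U) : zsec Q U := (a : O U) *: (s : F U).
Let scalefN (U V : opens X) (VU : V `<=` U) a s :
  zres Q VU (scalef a s) = scalef (zres P VU a) (zres Q VU s).
Proof. exact: (linearZ_LR (mres F VU)). Qed.

Definition mgerm (U : opens X) (Ux : oset U x) (s : F U) : mstalk F x :=
  @germ _ Q _ _ Ux s.

Lemma mgermD (U : opens X) (Ux : oset U x) (s t : F U) :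
  mgerm Ux (s + t) = mgerm Ux s + mgerm Ux t.
Proof. exact: (@germD X Q x U Ux). Qed.

Let scale : rstalk O x -> mstalk F x -> mstalk F x := stalk_op2 scalef.

Let scaleE (U : opens X) (Ux : oset U x) (a : O U) (s : F U) :
  scale (rgerm Ux a) (mgerm Ux s) = mgerm Ux (a *: s).
Proof. exact: stalk_op2E. Qed.

Fact mstalk_scaleA a b v : scale a (scale b v) = scale (a * b) v.
Proof.
have [U [Ux [a' [b' [v' [-> -> ->]]]]]] := germ_surj3 a b v.
by rewrite -[germ Ux v']/(mgerm Ux v') -!/(rgerm _ _) !scaleE -rgermM scaleE scalerA.
Qed.

Fact mstalk_scale1 : left_id 1 scale.
Proof.
move=> v; have [U [Ux [v' ->]]] := germ_surj v.
by rewrite -(rgerm1 O Ux) -[germ Ux v']/(mgerm Ux v') scaleE scale1r.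
Qed.

Fact mstalk_scaleDr : right_distributive scale +%R.
Proof.
move=> a v w; have [U [Ux [a' [v' [w' [-> -> ->]]]]]] := germ_surj3 a v w.
rewrite -[germ Ux v']/(mgerm Ux v') -[germ Ux w']/(mgerm Ux w') -/(rgerm _ _).
by rewrite -mgermD !scaleE scalerDr mgermD.
Qed.

Fact mstalk_scaleDl v : {morph scale^~ v : a b / a + b}.
Proof.
move=> a b; have [U [Ux [a' [b' [v' [-> -> ->]]]]]] := germ_surj3 a b v.
have e : germ Ux a' + germ Ux b' = rgerm Ux ((a' : O U) + b') by rewrite -germD.
by rewrite e -[germ Ux v']/(mgerm Ux v') -!/(rgerm _ _) !scaleE scalerDl mgermD.
Qed.

HB.instance Definition _ := GRing.Zmodule_isLmodule.Build (rstalk O x)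
  (mstalk F x) mstalk_scaleA mstalk_scale1 mstalk_scaleDr mstalk_scaleDl.

Lemma mgermZ (U : opens X) (Ux : oset U x) (a : O U) (s : F U) :
  mgerm Ux (a *: s) = rgerm Ux a *: mgerm Ux s.
Proof. by rewrite -scaleE. Qed.

Lemma mgerm_surj (c : mstalk F x) :
  exists (U : opens X) (Ux : oset U x) (s : F U), c = mgerm Ux s.
Proof. exact: (@germ_surj X Q x c). Qed.

End StalkMod.

Definition mstalk_gen (X : topologicalType) (O : rpresheaf X) (F : mpresheaf O)
    (x y : X) (xy : closure [set x] y) : mstalk F y -> mstalk F x :=
  @stalk_gen X (mpresheaf_z F) x y xy.

Definition mstalk_map (X : topologicalType) (O : rpresheaf X) (F H : mpresheaf O)
    (f : mhom F H) (x : X) : mstalk F x -> mstalk H x :=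
  @stalk_op1 X x (mpresheaf_z F) (mpresheaf_z H) (fun U => f U).

Section StalkMaps.
Variables (X : topologicalType) (O : rpresheaf X).

Lemma mstalk_genE (F : mpresheaf O) (x y : X) (xy : closure [set x] y)
    (U : opens X) (Uy : oset U y) (Ux : oset U x) (s : F U) :
  mstalk_gen xy (mgerm Uy s) = mgerm Ux s.
Proof. exact: stalk_genE. Qed.

Fact mstalk_gen_linear (F : mpresheaf O) (x y : X) (xy : closure [set x] y) :
  linear_for (@rstalk_gen X O x y xy \; *:%R) (@mstalk_gen X O F x y xy).
Proof.
move=> a v w; have [U [Uy [a' [v' [w' [-> -> ->]]]]]] := germ_surj3 a v w.
rewrite -[germ Uy v']/(mgerm Uy v') -[germ Uy w']/(mgerm Uy w').
have Ux := generize xy Uy; rewrite -!/(rgerm _ _) -mgermZ -mgermD.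
by rewrite /= !(mstalk_genE xy Uy Ux) (rstalk_genE xy Uy Ux) mgermD mgermZ.
Qed.

HB.instance Definition _ (F : mpresheaf O) (x y : X) (xy : closure [set x] y) :=
  GRing.isLinear.Build (rstalk O y) (mstalk F y) (mstalk F x)
    (@rstalk_gen X O x y xy \; *:%R) (@mstalk_gen X O F x y xy)
    (@mstalk_gen_linear F x y xy).

Lemma mstalk_mapE (F H : mpresheaf O) (f : mhom F H) (x : X)
    (U : opens X) (Ux : oset U x) (s : F U) :
  mstalk_map f (mgerm Ux s) = mgerm Ux (f U s).
Proof. by apply: stalk_op1E => U' V' VU s'; exact: mh_nat. Qed.

Fact mstalk_map_linear (F H : mpresheaf O) (f : mhom F H) (x : X) :
  linear (@mstalk_map X O F H f x).
Proof.
move=> a v w; have [U [Ux [a' [v' [w' [-> -> ->]]]]]] := germ_surj3 a v w.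
rewrite -[germ Ux v']/(mgerm Ux v') -[germ Ux w']/(mgerm Ux w').
rewrite -!/(rgerm _ _) -mgermZ -mgermD !mstalk_mapE -mgermZ -mgermD.
by rewrite linearP.
Qed.

HB.instance Definition _ (F H : mpresheaf O) (f : mhom F H) (x : X) :=
  GRing.isLinear.Build (rstalk O x) (mstalk F x) (mstalk H x) *:%R
    (@mstalk_map X O F H f x) (@mstalk_map_linear F H f x).

End StalkMaps.

Section Coherent.
Variables (X : topologicalType) (O : rpresheaf X).

Section FreeModule.
Variable n : nat.

Definition free_res (U V : opens X) (VU : V `<=` U) (a : 'rV[O U]_n) :
  'rV[O V]_n := map_mx (rres O VU) a.

Fact free_res_linear (U V : opens X) (VU : V `<=` U) :
  linear_for (rres O VU \; *:%R) (@free_res U V VU).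
Proof. by move=> a v w; apply/rowP => i; rewrite !mxE rmorphD rmorphM. Qed.

HB.instance Definition _ (U V : opens X) (VU : V `<=` U) :=
  GRing.isLinear.Build (O U) 'rV[O U]_n 'rV[O V]_n (rres O VU \; *:%R)
    (@free_res U V VU) (@free_res_linear U V VU).

Fact free_res_id (U : opens X) (UU : U `<=` U) (a : 'rV[O U]_n) :
  free_res UU a = a.
Proof. by apply/rowP => i; rewrite mxE rres_id. Qed.

Fact free_res_comp (U V W : opens X) (VU : V `<=` U) (WV : W `<=` V)
  (WU : W `<=` U) (a : 'rV[O U]_n) : free_res WV (free_res VU a) = free_res WU a.
Proof. by apply/rowP => i; rewrite !mxE; exact: rres_comp. Qed.

Definition free_module : mpresheaf O :=
  @MPresheaf X O (fun U => 'rV[O U]_n)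
    (fun U V VU => @free_res U V VU) free_res_id free_res_comp.

End FreeModule.

(* The subsheaf K of the restriction of M to U is of finite type: near every
   point of U, finitely many sections r of K define a surjective morphism of
   sheaves onto K. *)
Definition finite_type_on (M : mpresheaf O) (U : opens X)
    (K : forall V : opens X, V `<=` U -> set (M V)) : Prop :=
  forall x, oset U x ->
    exists (V : opens X) (VU : V `<=` U) (m : nat) (r : 'I_m -> M V),
      [/\ oset V x, forall j, K V VU (r j) &
        forall (W : opens X) (WV : W `<=` V) (t : M W),
          K W (subset_trans WV VU) t ->
        forall y, oset W y ->
          exists (W' : opens X) (WW : W' `<=` W) (b : 'I_m -> O W'),
            oset W' y /\
            mres M WW t = \sum_j b j *: mres M (subset_trans WW WV) (r j)].

Definition finite_type (M : mpresheaf O) : Prop :=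
  @finite_type_on M (opensT X) (fun V _ => setT).

(* The kernel of the morphism from O^n to M over U defined by sections
   s_1, ..., s_n of M over U *)
Definition relations (M : mpresheaf O) (U : opens X) (n : nat) (s : 'I_n -> M U)
    (V : opens X) (VU : V `<=` U) : set (free_module n V) :=
  [set a : 'rV[O V]_n | \sum_i a ord0 i *: mres M VU (s i) = 0].

Definition coherent (M : mpresheaf O) : Prop :=
  finite_type M /\
  forall (U : opens X) (n : nat) (s : 'I_n -> M U),
    @finite_type_on (free_module n) U (relations s).

End Coherent.

(* Coherence is Serre's condition on a ringed space; on a locally noetherian scheme
   it amounts to being locally the sheaf of a finitely generated module. *)
Record coherent_sheaf (X : ringed_space) := CoherentSheaf {
  coh_module :> mpresheaf (rs_O X);
  coh_sheaf : mpresheaf_is_sheaf coh_module;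
  coh_coherent : coherent coh_module }.

Record lr_poset := LRPoset {
  lrp_disp : Order.disp_t;
  lrp_pt :> porderType lrp_disp;
  lrp_O : lrp_pt -> comPzRingType;
  lrp_res : forall x y : lrp_pt, (x <= y)%O -> {rmorphism lrp_O y -> lrp_O x};
  lrp_res_id : forall (x : lrp_pt) (xx : (x <= x)%O) a, lrp_res xx a = a;
  lrp_res_comp : forall (x y z : lrp_pt) (xy : (x <= y)%O) (yz : (y <= z)%O)
    (xz : (x <= z)%O) a, lrp_res xy (lrp_res yz a) = lrp_res xz a;
  lrp_local : forall x : lrp_pt, local_ring (lrp_O x) }.

Record psh (C : lr_poset) := Psh {
  psh_mod :> forall x : C, lmodType (lrp_O x);
  psh_res : forall (x y : C) (xy : (x <= y)%O),
    {linear psh_mod y -> psh_mod x | lrp_res xy \; *:%R};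
  psh_res_id : forall (x : C) (xx : (x <= x)%O) v, psh_res xx v = v;
  psh_res_comp : forall (x y z : C) (xy : (x <= y)%O) (yz : (y <= z)%O)
    (xz : (x <= z)%O) v, psh_res xy (psh_res yz v) = psh_res xz v }.

Record psh_hom (C : lr_poset) (G H : psh C) := PshHom {
  psh_fun :> forall x : C, {linear G x -> H x};
  psh_nat : forall (x y : C) (xy : (x <= y)%O) (v : G y),
    psh_res H xy (psh_fun y v) = psh_fun x (psh_res G xy v) }.

Section Psh.
Variable C : lr_poset.

Lemma psh_hom_ext (G H : psh C) (f g : psh_hom G H) :
  (forall x v, f x v = g x v) -> f = g.
Proof.
case: f g => [f fN] [g gN] /= e.
have {}e : f = g.
  by apply: functional_extensionality_dep => x; apply: linear_ext; exact: e.
by rewrite -{}e in gN *; rewrite (Prop_irrelevance fN gN).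
Qed.

Definition psh_id (G : psh C) : psh_hom G G :=
  @PshHom C G G (fun x => idfun) (fun _ _ _ _ => erefl).

Fact psh_comp_nat (F G H : psh C) (g : psh_hom G H) (f : psh_hom F G)
    (x y : C) (xy : (x <= y)%O) (v : F y) :
  psh_res H xy ((g y \o f y) v) = (g x \o f x) (psh_res F xy v).
Proof. by rewrite /= !psh_nat. Qed.

Definition psh_comp (F G H : psh C) (g : psh_hom G H) (f : psh_hom F G) :
  psh_hom F H := @PshHom C F H (fun x => g x \o f x) (psh_comp_nat g f).

End Psh.

Definition points (X : scheme) : Type := rs_pt X.

Fact specialization_display : Order.disp_t.
Proof. exact: (Order.Disp tt tt). Qed.

Section Points.
Variable X : scheme.

(* x <= y iff y lies in the closure of x, so generic points are minimal. *)
Definition specializes (x y : points X) : bool :=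
  `[< @closure (rs_pt X) [set x] y >].

Fact specializes_refl : reflexive specializes.
Proof. by move=> x; apply/asboolP; exact: subset_closure. Qed.

Fact specializes_trans : transitive specializes.
Proof.
move=> y x z /asboolP xy /asboolP yz; apply/asboolP => B.
rewrite nbhsE => -[V [Vo Vz] VB]; exists x; split=> //; apply: VB.
by apply: (generize xy (U := Opens Vo)); exact: (generize yz (U := Opens Vo)).
Qed.

Fact specializes_anti : antisymmetric specializes.
Proof.
move=> x y /andP[/asboolP xy /asboolP yx].
have [A [f [[finj fop _] [p _ fp]]]] := sch_affine x.
have fT : open (range f) by apply: fop; exact: openT.
have [q _ fq] : range f y by apply: (@generize X y x yx (Opens fT)); exists p.
rewrite -fp -fq; congr (f _).
have sub (p' q' : spec A) : closure [set f p'] (f q') -> p' `<=` q'.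
  move=> pq a pa; apply: contrapT => qa.
  have Do : open [set r : spec A | ~ ([set a] `<=` r)] by exists [set a].
  have [|r ra /finj e] := generize pq (U := Opens (fop _ Do)).
    by exists q' => // h; apply: qa; exact: h.
  by apply: ra; rewrite e => _ ->.
rewrite -fp -fq in xy yx.
by apply: spec_eq; apply/seteqP; split; apply: sub.
Qed.

HB.instance Definition _ := Choice.on (points X).
HB.instance Definition _ := Order.Le_isPOrder.Build specialization_display
  (points X) specializes_refl specializes_anti specializes_trans.

Lemma le_closure (x y : points X) : (x <= y)%O -> @closure (rs_pt X) [set x] y.
Proof. by move=> /asboolP. Qed.

Fact points_res_id (x : points X) (xx : (x <= x)%O) (a : rstalk (rs_O X) x) :
  rstalk_gen (le_closure xx) a = a.
Proof.
have [U [Ux [s ->]]] := germ_surj a.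
by rewrite -/(rgerm _ _) (rstalk_genE _ Ux).
Qed.

Fact points_res_comp (x y z : points X) (xy : (x <= y)%O) (yz : (y <= z)%O)
    (xz : (x <= z)%O) (a : rstalk (rs_O X) z) :
  rstalk_gen (le_closure xy) (rstalk_gen (le_closure yz) a) =
  rstalk_gen (le_closure xz) a.
Proof.
have [U [Uz [s ->]]] := germ_surj a; rewrite -/(rgerm _ _).
have Uy := generize (le_closure yz) Uz; have Ux := generize (le_closure xy) Uy.
by rewrite (rstalk_genE _ Uz Uy) (rstalk_genE _ Uy Ux) (rstalk_genE _ Uz Ux).
Qed.

Definition associated_lr_poset : lr_poset :=
  @LRPoset specialization_display (points X : porderType _)
    (fun x => rstalk (rs_O X) (x : rs_pt X))
    (fun x y xy => @rstalk_gen _ (rs_O X) x y (le_closure xy))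
    points_res_id points_res_comp (@sch_local X).

End Points.

Record category := Category {
  obj :> Type;
  hom : obj -> obj -> Type;
  idm : forall a, hom a a;
  ccomp : forall a b c, hom b c -> hom a b -> hom a c;
  ccomp1f : forall a b (f : hom a b), ccomp (idm b) f = f;
  ccompf1 : forall a b (f : hom a b), ccomp f (idm a) = f;
  ccompA : forall a b c d (h : hom c d) (g : hom b c) (f : hom a b),
    ccomp h (ccomp g f) = ccomp (ccomp h g) f }.

Record functor (C D : category) := Functor {
  fobj :> C -> D;
  fmap : forall a b : C, hom a b -> hom (fobj a) (fobj b);
  fmap1 : forall a : C, fmap (idm a) = idm (fobj a);
  fmapM : forall (a b c : C) (g : hom b c) (f : hom a b),
    fmap (ccomp g f) = ccomp (fmap g) (fmap f) }.

Definition fully_faithful (C D : category) (S : functor C D) : Prop :=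
  forall (a b : C) (phi : hom (S a) (S b)),
    exists! psi : hom a b, fmap S psi = phi.

Definition PSh (C : lr_poset) : category.
Proof.
by refine (@Category (psh C) (@psh_hom C) (@psh_id C) (@psh_comp C) _ _ _);
  move=> *; exact: psh_hom_ext.
Defined.

Definition Coh (X : ringed_space) : category.
Proof.
by refine (@Category (coherent_sheaf X) (fun F H => mhom F H)
  (fun F => mhom_id F) (fun F G H g f => mhom_comp g f) _ _ _);
  move=> *; exact: mhom_ext.
Defined.

Section Specialization.
Variable X : scheme.

Fact specialization_id (F : mpresheaf (rs_O X)) (x : points X)
    (xx : (x <= x)%O) (v : mstalk F x) : mstalk_gen (le_closure xx) v = v.
Proof.
have [U [Ux [s ->]]] := mgerm_surj v.
by rewrite (mstalk_genE _ Ux).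
Qed.

Fact specialization_comp (F : mpresheaf (rs_O X)) (x y z : points X)
    (xy : (x <= y)%O) (yz : (y <= z)%O) (xz : (x <= z)%O) (v : mstalk F z) :
  mstalk_gen (le_closure xy) (mstalk_gen (le_closure yz) v) =
  mstalk_gen (le_closure xz) v.
Proof.
have [U [Uz [s ->]]] := mgerm_surj v.
have Uy := generize (le_closure yz) Uz; have Ux := generize (le_closure xy) Uy.
by rewrite (mstalk_genE _ Uz Uy) (mstalk_genE _ Uy Ux) (mstalk_genE _ Uz Ux).
Qed.

Definition specialization_obj (F : mpresheaf (rs_O X)) :
    psh (associated_lr_poset X) :=
  @Psh (associated_lr_poset X) (fun x => mstalk F (x : rs_pt X))
    (fun x y xy => @mstalk_gen _ (rs_O X) F x y (le_closure xy))
    (specialization_id (F := F)) (specialization_comp (F := F)).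

Fact specialization_nat (F H : mpresheaf (rs_O X)) (f : mhom F H)
    (x y : points X) (xy : (x <= y)%O) (v : mstalk F y) :
  mstalk_gen (le_closure xy) (mstalk_map f v) =
  mstalk_map f (mstalk_gen (le_closure xy) v).
Proof.
have [U [Uy [s ->]]] := mgerm_surj v; have Ux := generize (le_closure xy) Uy.
by rewrite mstalk_mapE !(mstalk_genE _ Uy Ux) mstalk_mapE.
Qed.

Definition specialization_hom (F H : mpresheaf (rs_O X)) (f : mhom F H) :
    psh_hom (specialization_obj F) (specialization_obj H) :=
  @PshHom _ (specialization_obj F) (specialization_obj H)
    (fun x => @mstalk_map _ _ F H f x) (specialization_nat f).

Definition specialization : functor (Coh X) (PSh (associated_lr_poset X)).
Proof.
refine (@Functor (Coh X) (PSh (associated_lr_poset X))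
  (fun F => specialization_obj F) (fun F H f => specialization_hom f) _ _).
- move=> F; apply: psh_hom_ext => x v /=.
  by have [U [Ux [s ->]]] := mgerm_surj v; rewrite mstalk_mapE.
- move=> F G H g f; apply: psh_hom_ext => x v /=.
  by have [U [Ux [s ->]]] := mgerm_surj v; rewrite !mstalk_mapE.
Defined.

End Specialization.

(* Main.v *)
From HB Require Import structures.
From mathcomp Require Import all_boot all_order all_algebra.
From mathcomp Require Import all_classical topology.
From mathcomp Require Import ring.
Require Import Defs.

Set Implicit Arguments.
Unset Strict Implicit.
Unset Printing Implicit Defensive.

Import GRing.Theory.
Local Open Scope classical_set_scope.
Local Open Scope ring_scope.

(** Let [phi] be a compatible family of maps on stalks from [F] to [H], and [s] a
    section of [F] near a point [y].  Write [phi_y (s_y)] as the germ at [y] of a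
    section [t] of [H].  By compatibility, [phi_x (s_x) = t_x] for every
    generization [x] of [y], but nothing is known yet at a point [z] close to [y]
    that does not generize [y].  The difference [w = phi_z (s_z) - t_z] does die at
    all common generizations of [y] and [z], and the heart of the proof is that, for
    [z] in a suitable neighbourhood of [y], this forces [w = 0]
    ([vanishing_near]).  Geometrically, [H] has finitely many associated points near
    [y]; once the closures of those that do not generize [y] are removed, a nonzero
    germ of [H] at [z] survives at an associated point that generizes both [z] and
    [y].  So [phi_z (s_z)] is locally the germ of a section of [H]; as [H] is a sheaf,
    these sections glue to the image of [s] ([germwise_section],
    [glue_stalk_maps]), and germs determine it ([mgerm_ext]).

    The associated points never appear explicitly.  Their effect is the property
    [vanishing_spreads] of a subquotient [L / K] of a module over a noetherian ring:
    it is stable under extensions, it holds for [A / I] with [I] prime by inspection,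
    for all ideals by noetherian induction, and hence for finitely generated modules
    ([vanishing_spreads_fg]).

    To apply it, no description of [H] on an affine open set by a module of sections
    is needed: coherence presents all stalks of [H] near [y] by the same finitely
    many generators and relations ([finite_type_gens], [coherent_rels]), the stalks of
    the structure sheaf on [Spec A] are the localizations of [A]
    ([open_immersion_chart]), and clearing denominators near [y] makes the relations
    have coefficients in [A]. *)

(** * Vanishing at common generizations, over a noetherian ring *)

Lemma noetherian_ideal_ind (A : comPzRingType) (P : set A -> Prop) :
  noetherian_ring A ->
  (forall I, is_ideal I ->
     (forall J, is_ideal J -> I `<=` J -> J <> I -> P J) -> P I) ->
  forall I, is_ideal I -> P I.
Proof.
move=> nA step I0 I0i; apply: contrapT => nP0.
pose T := {I : set A | is_ideal I /\ ~ P I}.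
have next (I : T) : exists J : T, sval I `<=` sval J /\ sval J <> sval I.
  case: I => I [Ii nPI] /=; apply: contrapT => nJ; apply: nPI.
  apply: step => // J Ji IJ JI; apply: contrapT => nPJ; apply: nJ.
  by exists (exist _ J (conj Ji nPJ)).
have [s sP] := choice next.
(* Otherwise the ideals violating P contain a strictly increasing sequence; its
   union is generated by elements of some term, where the sequence stops. *)
pose c n : set A := sval (iter n s (exist _ I0 (conj I0i nP0) : T)).
have ci n : is_ideal (c n) by rewrite /c; case: (iter _ _ _) => J [].
have cS n : c n `<=` c n.+1 by have [] := sP (iter n s (exist _ I0 (conj I0i nP0))).
have cneq n : c n.+1 <> c n by have [] := sP (iter n s (exist _ I0 (conj I0i nP0))).
have cle m n : (m <= n)%N -> c m `<=` c n.
  move=> /subnK <-; elim: (n - m)%N => // k IH; rewrite addSn.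
  exact: subset_trans IH (cS _).
have Ui : is_ideal (\bigcup_n c n).
  split; first by exists 0%N => //; have [] := ci 0%N.
    move=> a b [m _ ca] [n _ cb]; exists (maxn m n) => //.
    have [_ cD _] := ci (maxn m n).
    by apply: cD; [apply: cle ca|apply: cle cb]; rewrite (leq_maxl, leq_maxr).
  by move=> r a [m _ ca]; exists m => //; have [_ _ cZ] := ci m; exact: cZ.
have [k [g gE]] := nA _ Ui.
have gU i : (\bigcup_n c n) (g i).
  rewrite gE; exists (fun j => (j == i)%:R).
  rewrite (bigD1 i) //= eqxx mul1r big1 ?addr0 // => j /negPf ->.
  by rewrite mul0r.
have /choice[N cN] : forall i, exists n, c n (g i).
  by move=> i; have [n _ h] := gU i; exists n.
pose m := \max_i N i.
apply: (cneq m); apply/seteqP; split => // a ca.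
have : (\bigcup_n c n) a by exists m.+1.
rewrite gE => -[d ->]; have [c0 cD cZ] := ci m.
elim/big_ind: _ => // i _; apply: cZ; apply: cle (cN i).
exact: leq_bigmax.
Qed.

Definition submodule (A : comPzRingType) (M : lmodType A) (K : set M) : Prop :=
  [/\ K 0, forall v w, K v -> K w -> K (v + w) & forall a v, K v -> K (a *: v)].

(** The image of [v] in the localization of [M / K] at [q] is zero. *)
Definition vanishes_at (A : comPzRingType) (M : lmodType A) (K : set M)
    (q : spec A) (v : M) : Prop :=
  exists u, ~ spec_ideal q u /\ K (u *: v).

(** Near any [p], an element of [L / K] vanishes at [q] as soon as it vanishes at the
    common generizations of [p] and [q]. *)
Definition vanishing_spreads (A : comPzRingType) (M : lmodType A)
    (K L : set M) : Prop :=
  forall p : spec A, exists g, ~ spec_ideal p g /\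
    forall q : spec A, ~ spec_ideal q g -> forall v, L v ->
      (forall r : spec A, r `<=` p -> r `<=` q -> vanishes_at K r v) ->
      vanishes_at K q v.

Lemma vanishing_spreadsW (A : comPzRingType) (M : lmodType A) (K L L' : set M) :
  L `<=` L' -> vanishing_spreads K L' -> vanishing_spreads K L.
Proof.
move=> LL' sp p; have [g [pg h]] := sp p; exists g; split=> // q qg v Lv.
by apply: h => //; exact: LL'.
Qed.

(** An element of [N / K] at [q] first vanishes in [N / L], so that a multiple of it by
    some [u] outside [q] lies in [L / K], where the hypothesis applies again. *)
Lemma vanishing_spreads_extension (A : comPzRingType) (M : lmodType A)
    (K L N : set M) : submodule K -> K `<=` L ->
  vanishing_spreads K L -> vanishing_spreads L N -> vanishing_spreads K N.
Proof.
move=> [_ _ KZ] KL spK spL p.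
have [g [pg hK]] := spK p; have [h [ph hL]] := spL p.
exists (g * h); split=> [|q qgh v Nv Kr]; first exact: notin_mul.
have [[_ _ qZ] _ _] := spec_prime q.
have qg : ~ spec_ideal q g by move=> qg; apply: qgh; rewrite mulrC; exact: qZ.
have qh : ~ spec_ideal q h by move=> qh; apply: qgh; exact: qZ.
have [|u [qu Lu]] := hL q qh v Nv.
  by move=> r rp rq; have [u [ru Ku]] := Kr r rp rq; exists u; split=> //; exact: KL.
have [|t [qt Kt]] := hK q qg _ Lu.
  move=> r rp rq; have [t [rt Kt]] := Kr r rp rq; exists t; split=> //.
  by rewrite scalerA mulrC -scalerA; exact: KZ.
by exists (t * u); split; [exact: notin_mul|rewrite -scalerA].
Qed.

Definition add_line (A : comPzRingType) (M : lmodType A) (K : set M) (w : M) :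
    set M := [set v | exists k a, K k /\ v = k + a *: w].

Lemma add_line_sub (A : comPzRingType) (M : lmodType A) (K : set M) (w : M) :
  K `<=` add_line K w.
Proof. by move=> k Kk; exists k, 0; rewrite scale0r addr0. Qed.

Lemma add_line_submodule (A : comPzRingType) (M : lmodType A) (K : set M) w :
  submodule K -> submodule (add_line K w).
Proof.
move=> [K0 KD KZ]; split; first exact: add_line_sub.
  move=> _ _ [k [a [Kk ->]]] [k' [a' [Kk' ->]]]; exists (k + k'), (a + a').
  by split; [exact: KD|rewrite scalerDl addrACA].
move=> b _ [k [a [Kk ->]]]; exists (b *: k), (b * a).
by split; [exact: KZ|rewrite scalerDr scalerA].
Qed.

(** The quotient of [K + A w] by [K] is [A / (K : w)]. *)
Lemma vanishing_spreads_line (A : comPzRingType) (M : lmodType A)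
    (K : set M) (w : M) : submodule K ->
  vanishing_spreads ([set a | K (a *: w)] : set A^o) setT ->
  vanishing_spreads K (add_line K w).
Proof.
move=> [K0 KD KZ] sp p; have [g [pg h]] := sp p; exists g; split=> //.
move=> q qg _ [k [a [Kk ->]]].
have E u : K (u *: (k + a *: w)) <-> K ((u * a) *: w).
  rewrite scalerDr scalerA; split=> [Ku|Ku].
    rewrite -[X in K X](addKr (u *: k)); apply: KD => //.
    by rewrite -scaleNr; exact: KZ.
  by apply: KD => //; exact: KZ.
move=> Kr; have [|u [qu Ku]] := h q qg a I.
  by move=> r rp rq; have [u [ru /E Ku]] := Kr r rp rq; exists u.
by exists u; split=> //; apply/E.
Qed.

(** When [I] is prime, [A / I] is a domain: if [I] lies in both [p] and [q], then [I] is
    itself a common generization, at which only zero vanishes; otherwise [A / I] is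
    zero at [q], or near [p].  When [a b] lies in [I] but neither factor does, [A / I]
    is an extension of [A / (I + A a)] by [A / (I : a)], and both ideals are larger. *)
Lemma vanishing_spreads_ideal (A : comPzRingType) (I : set A) :
  noetherian_ring A -> is_ideal I -> vanishing_spreads (I : set A^o) setT.
Proof.
move=> nA; move: I; apply: noetherian_ideal_ind => // I Ii IH.
have [I0 ID IZ] := Ii.
have Is : submodule (I : set A^o) by split=> // a v /IZ.
have [I1|I1] := pselect (I 1).
  move=> p; exists 1; split; first exact: notin_1.
  move=> q _ v _ _; exists 1; split; first exact: notin_1.
  by rewrite scale1r -[v]mulr1; exact: IZ.
have [Ip|nIp] := pselect (prime_ideal I).
  move=> p; have [Isp|/existsNP[g /not_implyP[Ig pg]]] := pselect (I `<=` p).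
    exists 1; split=> [|q _ v _ Kr]; first exact: notin_1.
    (* g = 1 works, according to whether I lies in q *)
    have [Isq|/existsNP[g /not_implyP[Ig qg]]] := pselect (I `<=` q).
      have [u [Iu Iuv]] := Kr (SpecPt Ip) Isp Isq.
      have [_ _ IM] := Ip; have [//|Iv] := IM _ _ Iuv.
      by exists 1; split; [exact: notin_1|rewrite scale1r].
    by exists g; split=> //; rewrite -[_ *: _]/(g * v) mulrC; exact: IZ.
  (* an element g of I outside p kills A / I wherever g does not vanish *)
  exists g; split=> // q qg v _ _; exists g; split=> //.
  by rewrite -[_ *: _]/(g * v) mulrC; exact: IZ.
(* I is neither A nor prime *)
have [a [b [Iab Ia Ib]]] : exists a b, [/\ I (a * b), ~ I a & ~ I b].
  apply: contrapT => h; apply: nIp; split=> // a b Iab.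
  apply: contrapT => /not_orP[Ia Ib]; apply: h; by exists a, b.
have Isub := @add_line_sub A A^o I a.
apply: (vanishing_spreads_extension Is Isub).
  apply: vanishing_spreads_line => //; apply: IH.
  - split=> [|u v|r u].
    + by rewrite /mkset scale0r.
    + by rewrite /mkset scalerDl; exact: ID.
    + by rewrite /mkset -scalerA; exact: IZ.
  - by move=> u Iu; rewrite /mkset -[_ *: _]/(u * a) mulrC; exact: IZ.
  - by move=> E; apply: Ib; rewrite -E /mkset -[_ *: _]/(b * a) mulrC.
apply: IH => //.
- by have [L0 LD LZ] := @add_line_submodule A A^o I a Is; split=> // r u; exact: LZ.
- move=> E; apply: Ia; rewrite -E; exists 0, 1; split=> //.
  by rewrite add0r scale1r.
Qed.

(** Adding the generators one at a time gives a filtration with cyclic quotients. *)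
Lemma vanishing_spreads_fg (A : comPzRingType) (M : lmodType A) :
  noetherian_ring A -> forall n (w : 'I_n -> M) (K : set M), submodule K ->
  vanishing_spreads K [set v | exists k a, K k /\ v = k + \sum_i a i *: w i].
Proof.
move=> nA; elim=> [|n IH] w K Ks.
  apply: (@vanishing_spreadsW _ _ _ _ (add_line K 0)) => [_ [k [a [Kk ->]]]|].
    by rewrite big_ord0 addr0; exact: add_line_sub.
  apply: vanishing_spreads_line => //; apply: vanishing_spreads_ideal => //.
  have [K0 _ _] := Ks.
  by split=> *; rewrite /mkset scaler0.
have L0s := add_line_submodule (w ord0) Ks.
apply: (vanishing_spreads_extension Ks (@add_line_sub _ _ K (w ord0))).
  apply: vanishing_spreads_line => //; apply: vanishing_spreads_ideal => //.
  have [K0 KD KZ] := Ks; split; rewrite /mkset.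
  - by rewrite scale0r.
  - by move=> a b; rewrite scalerDl; exact: KD.
  - by move=> r a; rewrite -scalerA; exact: KZ.
apply: vanishing_spreadsW (IH (fun i => w (lift ord0 i)) _ L0s).
move=> _ [k [a [Kk ->]]]; exists (k + a ord0 *: w ord0), (fun i => a (lift ord0 i)).
by split; [exists k, (a ord0)|rewrite big_ord_recl addrA].
Qed.

Lemma vanishing_spreads_free (A : comPzRingType) m (K : set 'rV[A]_m) :
  noetherian_ring A -> submodule K -> vanishing_spreads K setT.
Proof.
move=> nA Ks; apply: vanishing_spreadsW
  (vanishing_spreads_fg nA (fun i => delta_mx 0 i) Ks) => v _.
exists 0, (fun i => v 0 i); have [K0 _ _] := Ks; split=> //.
by rewrite add0r -row_sum_delta.
Qed.

(** * Germs, and presentations of the stalks of a coherent sheaf *)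

Lemma nbhs_opens (X : topologicalType) (x : X) (P : set X) :
  nbhs x P -> exists W : opens X, oset W x /\ W `<=` P.
Proof. by rewrite nbhsE => -[W [Wo Wx] WP]; exists (Opens Wo). Qed.

Lemma opens_nbhs (X : topologicalType) (x : X) (W : opens X) :
  oset W x -> nbhs x W.
Proof. by move=> Wx; apply: open_nbhs_nbhs; split=> //; exact: oset_open. Qed.

Section Germs.
Variables (X : topologicalType) (O : rpresheaf X).

Lemma rgerm_res (x : X) (U V : opens X) (Ux : oset U x) (Vx : oset V x)
    (VU : V `<=` U) (s : O U) : rgerm Vx (rres O VU s) = rgerm Ux s.
Proof. exact: (@germ_res X (rpresheaf_z O)). Qed.

Lemma rgermD (x : X) (U : opens X) (Ux : oset U x) (s t : O U) :
  rgerm Ux (s + t) = rgerm Ux s + rgerm Ux t.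
Proof. exact: (@germD X (rpresheaf_z O)). Qed.

Fact rgerm_zmod_morphism (x : X) (U : opens X) (Ux : oset U x) :
  zmod_morphism (@rgerm X O x U Ux).
Proof. by move=> s t; apply: (canRL (addrK _)); rewrite -rgermD subrK. Qed.

Fact rgerm_monoid_morphism (x : X) (U : opens X) (Ux : oset U x) :
  monoid_morphism (@rgerm X O x U Ux).
Proof. by split=> [|s t]; [exact: rgerm1|exact: rgermM]. Qed.

HB.instance Definition _ (x : X) (U : opens X) (Ux : oset U x) :=
  GRing.isZmodMorphism.Build (O U) (rstalk O x) (@rgerm X O x U Ux)
    (rgerm_zmod_morphism Ux).
HB.instance Definition _ (x : X) (U : opens X) (Ux : oset U x) :=
  GRing.isMonoidMorphism.Build (O U) (rstalk O x) (@rgerm X O x U Ux)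
    (rgerm_monoid_morphism Ux).

Lemma rgerm_surj (x : X) (c : rstalk O x) :
  exists (U : opens X) (Ux : oset U x) (s : O U), c = rgerm Ux s.
Proof. exact: (@germ_surj X (rpresheaf_z O)). Qed.

Lemma rgermP (x : X) (U V : opens X) (Ux : oset U x) (Vx : oset V x)
    (s : O U) (t : O V) :
  rgerm Ux s = rgerm Vx t <->
  exists (W : opens X) (WU : W `<=` U) (WV : W `<=` V),
    oset W x /\ rres O WU s = rres O WV t.
Proof. exact: (@germP X (rpresheaf_z O)). Qed.

(** Finitely many germs at a point are germs of sections over one neighbourhood. *)
Lemma rgerm_lift n (x : X) (c : 'I_n -> rstalk O x) :
  exists (W : opens X) (Wx : oset W x) (s : 'I_n -> O W),
    forall i, c i = rgerm Wx (s i).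
Proof.
have /choice[U UP] i :
    exists U : opens X, exists (Ux : oset U x) (s : O U), c i = rgerm Ux s.
  exact: rgerm_surj.
have [|W [Wx WU]] := @nbhs_opens X x [set z | forall i, oset (U i) z].
  by apply: filter_forall => i; have [Ux _] := UP i; exact: opens_nbhs.
have /choice[s sP] i : exists s : O W, c i = rgerm Wx s.
  have [Ux [s ->]] := UP i.
  have WUi : W `<=` U i by move=> z /WU; exact.
  by exists (rres O WUi s); rewrite (rgerm_res Ux).
by exists W, Wx, s.
Qed.

Lemma rgerm_eq_near (x : X) (U : opens X) (Ux : oset U x) (s t : O U) :
  rgerm Ux s = rgerm Ux t ->
  \forall z \near x, forall Uz : oset U z, rgerm Uz s = rgerm Uz t.
Proof.
move=> /rgermP[W [WU [WU' [Wx e]]]]; apply: filterS (opens_nbhs Wx) => z Wz Uz.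
by rewrite -(rgerm_res Uz Wz WU) e (rgerm_res Uz).
Qed.

Variable M : mpresheaf O.

Lemma mgerm_res (x : X) (U V : opens X) (Ux : oset U x) (Vx : oset V x)
    (VU : V `<=` U) (s : M U) : mgerm Vx (mres M VU s) = mgerm Ux s.
Proof. exact: (@germ_res X (mpresheaf_z M)). Qed.

Fact mgerm_zmod_morphism (x : X) (U : opens X) (Ux : oset U x) :
  zmod_morphism (@mgerm X O M x U Ux).
Proof. by move=> s t; apply: (canRL (addrK _)); rewrite -mgermD subrK. Qed.

HB.instance Definition _ (x : X) (U : opens X) (Ux : oset U x) :=
  GRing.isZmodMorphism.Build (M U) (mstalk M x) (@mgerm X O M x U Ux)
    (mgerm_zmod_morphism Ux).

Lemma mgermP (x : X) (U V : opens X) (Ux : oset U x) (Vx : oset V x)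
    (s : M U) (t : M V) :
  mgerm Ux s = mgerm Vx t <->
  exists (W : opens X) (WU : W `<=` U) (WV : W `<=` V),
    oset W x /\ mres M WU s = mres M WV t.
Proof. exact: (@germP X (mpresheaf_z M)). Qed.

Lemma mgerm_ext (U : opens X) (s t : M U) : mpresheaf_is_sheaf M ->
  (forall x (Ux : oset U x), mgerm Ux s = mgerm Ux t) -> s = t.
Proof.
move=> Msh st.
have /choice[W WP] (i : {x | oset U x}) : exists W : opens X, exists WU : W `<=` U,
    oset W (sval i) /\ mres M WU s = mres M WU t.
  case: i => x Ux /=; have /mgermP[W [WU [WU' [Wx e]]]] := st x Ux.
  by exists W, WU; split=> //; rewrite e; congr (mres M _ t); exact: Prop_irrelevance.
pose WU i := projT1 (cid (WP i)).
have WUP i : oset (W i) (sval i) /\ mres M (WU i) s = mres M (WU i) t.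
  by rewrite /WU; case: cid.
have cov : U `<=` \bigcup_i W i.
  by move=> x Ux; exists (exist _ x Ux) => //; have [] := WUP (exist _ x Ux).
have [|r [_ rU]] := Msh _ U W WU cov (fun i => mres M (WU i) s).
  move=> i j /=.
  have WW : opensI (W i) (W j) `<=` U by move=> z [/WU].
  by rewrite !(mres_comp _ _ WW).
rewrite -(rU s) // -(rU t) // => i /=.
by have [] := WUP i.
Qed.

(** On germs, generating sections of a sheaf generate all stalks near [y]. *)
Lemma finite_type_gens : finite_type M -> forall y : X,
  exists (V : opens X) (m : nat) (r : 'I_m -> M V), oset V y /\
    forall z (Vz : oset V z) (w : mstalk M z),
      exists c : 'I_m -> rstalk O z, w = \sum_j c j *: mgerm Vz (r j).
Proof.
move=> ft y; have [V [_ [m [r [Vy _ gen]]]]] := ft y I.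
exists V, m, r; split=> // z Vz w.
have [U [Uz [t ->]]] := mgerm_surj w.
have IU := @opensIl _ U V; have IV := @opensIr _ U V.
have [W' [WW [b [W'z e]]]] := gen _ IV (mres M IU t) I z (conj Uz Vz).
exists (fun j => rgerm W'z (b j)).
rewrite -(mgerm_res Uz (conj Uz Vz : oset (opensI U V) z) IU).
rewrite -(mgerm_res _ W'z WW) e raddf_sum; apply: eq_bigr => j _.
by rewrite /= mgermZ (mgerm_res Vz).
Qed.

(** Finitely many tuples of sections generate, at all points near [y], the module of
    relations between the germs of the [r j]: a relation between germs at [z] holds
    between sections over some neighbourhood of [z], to which coherence applies. *)
Lemma coherent_rels : coherent M ->
  forall (V : opens X) (m : nat) (r : 'I_m -> M V) (y : X), oset V y ->
  exists (V' : opens X) (VV : V' `<=` V) (l : nat) (k : 'I_l -> 'I_m -> O V'),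
    [/\ oset V' y,
      forall z (Vz : oset V z) (Vz' : oset V' z) i,
        \sum_j rgerm Vz' (k i j) *: mgerm Vz (r j) = 0 &
      forall z (Vz : oset V z) (Vz' : oset V' z) (c : 'I_m -> rstalk O z),
        \sum_j c j *: mgerm Vz (r j) = 0 ->
        exists b : 'I_l -> rstalk O z,
          forall j, c j = \sum_i b i * rgerm Vz' (k i j)].
Proof.
move=> [_ coh] V m r y Vy; have [V' [VV [l [k [V'y kr gen]]]]] := coh V m r y Vy.
exists V', VV, l, (fun i j => (k i : 'rV[O V']_m) ord0 j); split=> //.
  move=> z Vz V'z i.
  have /(congr1 (mgerm V'z)) := kr i; rewrite raddf_sum raddf0 => e.
  rewrite -[RHS]e; apply: eq_bigr => j _; by rewrite /= mgermZ (mgerm_res Vz).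
move=> z Vz V'z c c0; have [U [Uz [s sE]]] := rgerm_lift c.
have IU := @opensIl _ U V'; have IV' := @opensIr _ U V'.
have IV : opensI U V' `<=` V := subset_trans IV' VV.
have Iz : oset (opensI U V') z by split.
have : mgerm Iz (\sum_j rres O IU (s j) *: mres M IV (r j)) = mgerm Iz 0.
  rewrite raddf0 raddf_sum -[RHS]c0; apply: eq_bigr => j _.
  by rewrite /= mgermZ (mgerm_res Vz) (rgerm_res Uz) -sE.
move=> /mgermP[W [WI [WI' [Wz]]]]; rewrite linear0 linear_sum /= => e.
have WV' : W `<=` V' := subset_trans WI IV'.
have WU : W `<=` U := subset_trans WI IU.
pose t : 'rV[O W]_m := \row_j rres O WU (s j).
have [|W' [WW [b [W'z E]]]] := gen W WV' t _ z Wz.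
  rewrite /relations /=; rewrite -[RHS]e; apply: eq_bigr => j _.
  rewrite mxE (linearZ_LR (mres M WI)) /= (mres_comp _ _ (subset_trans WV' VV)).
  by rewrite (rres_comp _ _ WU).
exists (fun i => rgerm W'z (b i)) => j; rewrite sE.
have /(congr1 (fun v : 'rV[O W']_m => rgerm W'z (v ord0 j))) := E.
rewrite summxE /= mxE mxE rmorph_sum (rgerm_res Wz) (rgerm_res Uz) => ->.
by apply: eq_bigr => i _; rewrite !mxE rmorphM /= (rgerm_res V'z).
Qed.

End Germs.

(** * Stalks on an affine open set *)

Section Constants.
Variables (A : comPzRingType) (U : opens (spec A)).

Definition spec_cst (a : A) : spec_O A U := SpecSec (@spec_cst_frac A U a).

Fact spec_cst_zmod_morphism : zmod_morphism spec_cst.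
Proof.
move=> a b; apply: spec_sec_eq => p Up /=.
by rewrite fracN fracD; apply: frac_eq1; ring.
Qed.

Fact spec_cst_monoid_morphism : monoid_morphism spec_cst.
Proof.
split=> [|a b]; apply: spec_sec_eq => p Up //=.
by rewrite fracM; apply: frac_eq1; ring.
Qed.

HB.instance Definition _ := GRing.isZmodMorphism.Build A (spec_O A U)
  spec_cst spec_cst_zmod_morphism.
HB.instance Definition _ := GRing.isMonoidMorphism.Build A (spec_O A U)
  spec_cst spec_cst_monoid_morphism.

End Constants.

(** What is used of an affine open set: the maps [A -> O_(pt q)] induced by [alpha] turn
    the stalks into the localizations of [A], as expressed by the last three fields. *)
Record affine_chart (X : ringed_space) (A : comPzRingType) (pt : spec A -> X)
    (R : opens X) (alpha : {rmorphism A -> rs_O X R}) : Prop := AffineChart {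
  chart_cont : continuous pt;
  chart_open : forall U, open U -> open (pt @` U);
  chart_in : forall q, oset R (pt q);
  chart_unit : forall q (Rq : oset R (pt q)) u, ~ spec_ideal q u ->
    exists c, c * rgerm Rq (alpha u) = 1;
  chart_frac : forall q (Rq : oset R (pt q)) c, exists u a,
    ~ spec_ideal q u /\ rgerm Rq (alpha u) * c = rgerm Rq (alpha a);
  chart_ker : forall q (Rq : oset R (pt q)) a, rgerm Rq (alpha a) = 0 ->
    exists u, ~ spec_ideal q u /\ u * a = 0 }.

Lemma open_basic (A : comPzRingType) (u : A) :
  open [set q : spec A | ~ spec_ideal q u].
Proof.
exists [set u]; apply/seteqP; split=> q /= h; first by move=> h'; apply/h/h'.
by move=> qu; apply: h => _ ->.
Qed.

(** Over open sets inside the image of [f], sections of the structure sheaf of [X] are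
    those of [Spec A], which are functions given locally by fractions; the image of
    an open set of [Spec A] is open, so fractions over it transfer to [X]. *)
Lemma open_immersion_chart (X : ringed_space) (A : comPzRingType)
    (f : rs_hom (Spec A) X) : open_immersion f ->
  exists (R : opens X) (alpha : {rmorphism A -> rs_O X R}), @affine_chart X A f R alpha.
Proof.
move=> [finj fop fbij].
pose R := Opens (fop _ openT).
have Rf q : oset R (f q) by exists q.
have [g gK Kg] := fbij R (fun _ h => h).
pose fR := opens_preim (rs_cont (r := f)) R.
have gD : zmod_morphism (g \o @spec_cst A fR).
  move=> a b /=. apply: (can_inj gK).
  by rewrite [RHS]rmorphB !Kg rmorphB.
have gM : monoid_morphism (g \o @spec_cst A fR).
  split=> [|a b] /=; apply: (can_inj gK).
    by rewrite [RHS]rmorph1 Kg rmorph1.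
  by rewrite [RHS]rmorphM !Kg rmorphM.
pose alpha : {rmorphism A -> rs_O X R} := HB.pack (g \o @spec_cst A fR)
  (GRing.isZmodMorphism.Build _ _ _ gD) (GRing.isMonoidMorphism.Build _ _ _ gM).
have alphaE a (W : opens X) (WR : W `<=` R) :
    rs_sharp f W (rres _ WR (alpha a)) = @spec_cst A _ a.
  have WR' : opens_preim (rs_cont (r := f)) W `<=` fR by move=> q /WR.
  rewrite -(rs_nat WR WR') /= Kg.
  exact: spec_sec_eq.
exists R, alpha; split=> //.
- exact: (rs_cont (r := f)).
(* units: the section 1 / u over the set where u does not vanish *)
- move=> q Rq u qu.
  have Do := @open_basic A u.
  pose W := Opens (fop _ Do).
  have WR : W `<=` R by move=> _ [p _ <-]; exists p.
  have Wq : oset W (f q) by exists q.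
  have WD p : f p \in oset W -> ~ spec_ideal p u.
    by rewrite inE => -[p' p'u /finj <-].
  pose fW := opens_preim (rs_cont (r := f)) W.
  have fWD p (Wp : oset fW p) : ~ spec_ideal p u by apply: WD; rewrite inE.
  have inv_frac : @locally_frac A fW (fun p Wp => frac 1 (fWD p Wp)).
    move=> p Wp; exists fW, (fun _ h => h), 1, u; split=> // p' Wp'.
    by exists (fWD p' Wp').
  have [h hK Kh] := fbij W WR.
  exists (rgerm Wq (h (SpecSec inv_frac))).
  rewrite -(rgerm_res Rq Wq WR) -rmorphM -(rgerm1 _ Wq); congr rgerm.
  apply: (can_inj hK); rewrite rmorphM Kh alphaE rmorph1.
  apply: spec_sec_eq => p Wp /=; rewrite fracM.
  by apply: frac_eq1; ring.
(* every germ is a fraction *)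
- move=> q Rq c; have [U [Uq [s ->]]] := rgerm_surj c.
  have [V [VU [a [b [Vq sV]]]]] :=
    sval_frac (rs_sharp f U s : spec_sec _) (Uq : oset (opens_preim _ U) q).
  have [qb _] := sV q Vq.
  pose W := Opens (fop _ (oset_open V)).
  have WR : W `<=` R by move=> _ [p _ <-]; exists p.
  have WU : W `<=` U by move=> _ [p /VU ? <-].
  have Wq : oset W (f q) by exists q.
  exists b, a; split=> //.
  rewrite -!(rgerm_res Rq Wq WR) -(rgerm_res Uq Wq WU) -rmorphM; congr rgerm.
  have [h hK Kh] := fbij W WR.
  apply: (can_inj hK); rewrite rmorphM !alphaE.
  have fWU : opens_preim (rs_cont (r := f)) W `<=` opens_preim (rs_cont (r := f)) U.
    by move=> p /WU.
  rewrite -(rs_nat WU fWU); apply: spec_sec_eq => p Wp /=.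
  have Vp : oset V p by case: Wp => p' Vp' /finj <-.
  have [pb sE] := sV p Vp.
  rewrite (Prop_irrelevance (fWU p Wp) (VU p Vp)) sE fracM.
  by apply: frac_eq1; ring.
(* the kernel: read the section at q *)
- move=> q Rq a; rewrite -(rmorph0 (rgerm Rq)).
  move=> /rgermP[W [WR [WR' [Wq /(congr1 (rs_sharp f W))]]]].
  rewrite alphaE rmorph0 rmorph0 =>
    /(congr1 (fun s : spec_sec (opens_preim (rs_cont (r := f)) W) => s q Wq)).
  move=> /fracP[u [qu e]]; exists u; split=> //.
  by move: e; rewrite mulr1 mul0r mulr0.
Qed.

(** * Vanishing at common generizations, for germs of a coherent sheaf *)

Lemma notin_prod (A : comPzRingType) (q : spec A) (I : Type) (s : seq I)
    (P : pred I) (u : I -> A) :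
  (forall i, ~ spec_ideal q (u i)) -> ~ spec_ideal q (\prod_(i <- s | P i) u i).
Proof.
move=> qu; elim/big_ind: _ => [|a b|i _]; [exact: notin_1|exact: notin_mul|].
exact: qu.
Qed.

(** A prime [r] contained in [q] specializes to [q], and continuity carries this over. *)
Lemma closure_spec (A : comPzRingType) (X : topologicalType) (pt : spec A -> X)
    (r q : spec A) : continuous pt -> r `<=` q -> closure [set pt r] (pt q).
Proof.
move=> ptc rq B Bq; have := ptc q B Bq; rewrite /= nbhsE.
move=> [D [[E ->] /= Eq] DB]; exists (pt r); split=> //; apply: DB => /= Er.
by apply: Eq => a /Er; exact: rq.
Qed.

Section Chart.
Variables (X : ringed_space) (A : comPzRingType) (pt : spec A -> X)
  (R : opens X) (alpha : {rmorphism A -> rs_O X R}).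
Hypothesis ch : affine_chart pt alpha.

Lemma chart_fracs (I : finType) q (Rq : oset R (pt q))
    (c : I -> rstalk (rs_O X) (pt q)) :
  exists u (a : I -> A), ~ spec_ideal q u /\
    forall i, rgerm Rq (alpha u) * c i = rgerm Rq (alpha (a i)).
Proof.
have /choice[u uP] i := chart_frac ch Rq (c i).
have [a aP] := choice uP.
exists (\prod_i u i), (fun i => (\prod_(j | j != i) u j) * a i); split=> [|i].
  by apply: notin_prod => i; have [] := aP i.
have [_ e] := aP i.
by rewrite (bigD1 i) //= !rmorphM mulrAC e mulrC.
Qed.

Lemma chart_kers (I : finType) q (Rq : oset R (pt q)) (a : I -> A) :
  (forall i, rgerm Rq (alpha (a i)) = 0) ->
  exists u, ~ spec_ideal q u /\ forall i, u * a i = 0.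
Proof.
move=> a0; have /choice[u uP] i := chart_ker ch (a0 i).
exists (\prod_i u i); split=> [|i].
  by apply: notin_prod => i; have [] := uP i.
by rewrite (bigD1 i) //= mulrAC; have [_ ->] := uP i; rewrite mul0r.
Qed.

End Chart.

(** Near [y], the stalks of [M] are presented by the generators [r j] and by relations
    which, up to the unit [e], have coefficients [kap] in [A].  So the stalk at [pt q]
    is the localization at [q] of [A^m / K], for the module [K] spanned by these
    relations, and [vanishing_spreads_free] applies. *)
Lemma vanishing_near (X : scheme) (M : mpresheaf (rs_O X)) (y : X) :
  locally_noetherian X -> coherent M ->
  exists V : opens X, oset V y /\ forall z, oset V z -> forall w : mstalk M z,
    (forall x, closure [set x] y -> forall xz : closure [set x] z,
       mstalk_gen xz w = 0) -> w = 0.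
Proof.
move=> hX cM; have [A [f [nA fim [p _ py]]]] := hX y.
have [R [alpha ch]] := open_immersion_chart fim.
move: (rs_map f) py ch => {f fim} pt py ch.
have Rp := chart_in ch; have ptc := chart_cont ch.
have [V [m [r [Vy gen]]]] := finite_type_gens (proj1 cM) y.
have [V' [_ [l [k [V'y krel kgen]]]]] := coherent_rels cM r Vy.
subst y.
(* e is a common denominator of the relations at y *)
have [e [kap [pe kapE]]] := chart_fracs ch (Rp p)
  (fun ij : 'I_l * 'I_m => rgerm V'y (k ij.1 ij.2)).
have RV'R := @opensIl _ R V'; have RV'V' := @opensIr _ R V'.
(* clearing the denominator e remains valid on a neighbourhood of y *)
have kapN : \forall z \near pt p, forall (Rz : oset R z) (V'z : oset V' z) i j,
    rgerm Rz (alpha e) * rgerm V'z (k i j) = rgerm Rz (alpha (kap (i, j))).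
  have : \forall z \near pt p, forall ij : 'I_l * 'I_m,
      forall Iz : oset (opensI R V') z,
      rgerm Iz (rres _ RV'R (alpha e) * rres _ RV'V' (k ij.1 ij.2)) =
      rgerm Iz (rres _ RV'R (alpha (kap ij))).
    apply: filter_forall => ij.
    apply: (@rgerm_eq_near _ _ _ (opensI R V') (conj (Rp p) V'y)).
    by rewrite rmorphM /= !(rgerm_res (Rp p)) (rgerm_res V'y) kapE.
  apply: filterS => z h Rz V'z i j; have := h (i, j) (conj Rz V'z).
  by rewrite rmorphM /= !(rgerm_res Rz) (rgerm_res V'z).
pose K : set 'rV[A]_m :=
  [set v | exists b : 'I_l -> A, forall j, v 0 j = \sum_i b i * kap (i, j)].
have Ks : submodule K.
  split.
  - by exists (fun=> 0) => j; rewrite mxE big1 // => i _; rewrite mul0r.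
  - move=> v w [b vE] [c wE]; exists (fun i => b i + c i) => j.
    by rewrite mxE vE wE -big_split; apply: eq_bigr => i _; rewrite mulrDl.
  - move=> a v [b vE]; exists (fun i => a * b i) => j.
    by rewrite mxE vE mulr_sumr; apply: eq_bigr => i _; rewrite mulrA.
have [g [pg gP]] := vanishing_spreads_free nA Ks p.
(* The neighbourhood where e is invertible and g does not vanish, where the
   relations hold with the coefficients kap, and where presentations are valid *)
pose D := Opens (chart_open ch (@open_basic A (e * g))).
have Dp : oset D (pt p) by exists p => //; exact: notin_mul.
have [V0 [V0p V0P]] := nbhs_opens (filterI (filterI (opens_nbhs Dp) kapN)
  (filterI (opens_nbhs Vy) (opens_nbhs V'y))).
exists V0; split=> // z V0z w w0.
have [[[q qeg qz] kapz] [Vz V'z]] := V0P _ V0z; subst z.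
have [[_ _ qZ] _ _] := spec_prime q.
have qe : ~ spec_ideal q e by move=> qe; apply: qeg; rewrite mulrC; exact: qZ.
have qg : ~ spec_ideal q g by move=> qg; apply: qeg; exact: qZ.
have [c wE] := gen _ Vz w.
(* Up to the unit u, the coefficients of w come from a vector a over A. *)
have [u [a [qu aE]]] := chart_fracs ch (Rp q) c.
have uwE : rgerm (Rp q) (alpha u) *: w =
    \sum_j rgerm (Rp q) (alpha (a j)) *: mgerm Vz (r j).
  by rewrite wE scaler_sumr; apply: eq_bigr => j _; rewrite scalerA aE.
(* w is zero exactly when a vanishes modulo K at q, which can be tested at the
   common generizations s of p and q; w vanishes there by hypothesis. *)
have [s sp sq|t [qt [b bE]]] := gP q qg (\row_j a j) I.
  have xy := closure_spec ptc sp; have xz := closure_spec ptc sq.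
  have V0s := generize xz V0z; have [[[s' s'eg ss'] kaps] [Vs V's]] := V0P _ V0s.
  have se : ~ spec_ideal s e by move=> /sq.
  have a0 : \sum_j rgerm (Rp s) (alpha (a j)) *: mgerm Vs (r j) = 0.
    have /(congr1 (mstalk_gen xz)) := uwE.
    rewrite linearZ_LR /= w0 // scaler0 linear_sum => /esym h.
    rewrite -[RHS]h; apply: eq_bigr => j _.
    by rewrite linearZ_LR /= (mstalk_genE xz Vz Vs) (rstalk_genE xz _ (Rp s)).
  have [b bE] := kgen _ Vs V's _ a0.
  have [t [beta [st betaE]]] := chart_fracs ch (Rp s) b.
  have [|t' [st' t'E]] := chart_kers ch (Rq := Rp s)
      (a := fun j => t * e * a j - \sum_i beta i * kap (i, j)).
    move=> j; rewrite rmorphB rmorphM rmorphM rmorph_sum /= rmorphB rmorphM.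
    rewrite rmorphM rmorph_sum /= bE mulr_sumr -sumrB big1 // => i _.
    rewrite !rmorphM /= -betaE -(kaps _ V's).
    by apply/eqP; rewrite subr_eq0; apply/eqP; ring.
  exists (t' * (t * e)); split; first by apply: notin_mul => //; exact: notin_mul.
  exists (fun i => t' * beta i) => j; rewrite !mxE.
  have /eqP := t'E j; rewrite mulrBr subr_eq0 -mulrA => /eqP E; rewrite -!mulrA E.
  by rewrite mulr_sumr; apply: eq_bigr => i _; rewrite mulrA.
(* t a lies in K, so e t u w is a combination of the relations and is thus zero *)
have tuw0 : rgerm (Rp q) (alpha (e * t * u)) *: w = 0.
  rewrite !rmorphM /= -scalerA uwE scaler_sumr.
  under eq_bigr => j _.
    have := bE j; rewrite !mxE => tE.
    rewrite scalerA -mulrA -rmorphM -rmorphM tE rmorph_sum rmorph_sum mulr_sumr.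
    rewrite scaler_suml.
    over.
  rewrite exchange_big big1 // => i _ /=.
  transitivity (rgerm (Rp q) (alpha (b i * e * e)) *:
      \sum_j rgerm V'z (k i j) *: mgerm Vz (r j)).
    rewrite scaler_sumr; apply: eq_bigr => j _; rewrite scalerA; congr (_ *: _).
    by rewrite !rmorphM /= -(kapz _ V'z); ring.
  by rewrite krel scaler0.
have [|d dE] := chart_unit ch (q := q) (Rp q) (u := e * t * u).
  by do 2!apply: notin_mul => //.
by rewrite -[w]scale1r -dE -scalerA tuw0 scaler0.
Qed.

(** * Gluing a family of maps on stalks *)

Section Gluing.
Variables (X : ringed_space) (F H : mpresheaf (rs_O X)).
Hypothesis Hsh : mpresheaf_is_sheaf H.
Variable phi : forall x : X, {linear mstalk F x -> mstalk H x}.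

(** The local sections agree on overlaps because they have the same germs there. *)
Lemma germwise_section (U : opens X) (s : F U) :
  (forall y, oset U y -> exists (V : opens X) (t : H V), oset V y /\
     forall z (Uz : oset U z) (Vz : oset V z), phi z (mgerm Uz s) = mgerm Vz t) ->
  exists t : H U, forall z (Uz : oset U z), mgerm Uz t = phi z (mgerm Uz s).
Proof.
move=> loc.
have /choice[V VP] (i : {y | oset U y}) : exists V : opens X,
    exists (VU : V `<=` U) (t : H V), oset V (sval i) /\
     forall z (Uz : oset U z) (Vz : oset V z), phi z (mgerm Uz s) = mgerm Vz t.
  case: i => y Uy /=; have [V [t [Vy tE]]] := loc y Uy.
  exists (opensI U V), (@opensIl _ U V), (mres H (@opensIr _ U V) t).
  split=> // z Uz [Uz' Vz]; rewrite (tE z Uz Vz); exact/esym/mgerm_res.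
pose VU i := projT1 (cid (VP i)).
have tP i := projT2 (cid (VP i)).
pose t i : H (V i) := projT1 (cid (tP i)).
have tE i : oset (V i) (sval i) /\ forall z (Uz : oset U z) (Vz : oset (V i) z),
    phi z (mgerm Uz s) = mgerm Vz (t i) := projT2 (cid (tP i)).
have cov : U `<=` \bigcup_i V i.
  by move=> y Uy; exists (exist _ y Uy) => //; have [] := tE (exist _ y Uy).
have [|r [rE _]] := Hsh VU cov (s := t).
  move=> i j; apply: (mgerm_ext Hsh) => z [Viz Vjz].
  have Uz := VU i z Viz.
  rewrite (mgerm_res Viz) (mgerm_res Vjz).
  by rewrite -(tE i).2 -(tE j).2.
exists r => z Uz; have [i _ Viz] := cov z Uz.
by rewrite ((tE i).2 z Uz Viz) -rE [in RHS](mgerm_res Uz).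
Qed.

Hypothesis phi_local : forall (U : opens X) (s : F U),
  exists t : H U, forall z (Uz : oset U z), mgerm Uz t = phi z (mgerm Uz s).

(** The sections given by [phi_local] are determined by their germs, so they depend
    linearly on [s] and are compatible with restriction. *)
Lemma glue_stalk_maps : exists psi : mhom F H,
  forall x v, mstalk_map psi v = phi x v.
Proof.
have fP (U : opens X) : {f : F U -> H U |
    forall s z (Uz : oset U z), mgerm Uz (f s) = phi z (mgerm Uz s)}.
  by apply: cid; have [f fP] := choice (@phi_local U); exists f.
pose f U := sval (fP U); have fE U := svalP (fP U).
have flin U : linear (f U).
  move=> a s t; apply: (mgerm_ext Hsh) => z Uz.
  by rewrite mgermD mgermZ /f !fE mgermD mgermZ linearP.
pose fl U : {linear F U -> H U} :=
  HB.pack (f U) (GRing.isLinear.Build _ _ _ _ _ (flin U)).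
have fnat (U V : opens X) (VU : V `<=` U) (s : F U) :
    mres H VU (fl U s) = fl V (mres F VU s).
  apply: (mgerm_ext Hsh) => z Vz; have Uz := VU z Vz.
  by rewrite (mgerm_res Uz) /= /f !fE (mgerm_res Uz).
exists (MHom fnat) => x v; have [U [Ux [s ->]]] := mgerm_surj v.
by rewrite mstalk_mapE /= /f fE.
Qed.

End Gluing.

(** * Full faithfulness *)

Theorem claim3p1 (X : scheme) (hX : noetherian_scheme X) :
  fully_faithful (specialization X).
Proof.
move=> F H phi; have [hXl _] := hX.
have Hsh := @coh_sheaf X H.
have [|psi psiE] := @glue_stalk_maps X F H Hsh (fun x => psh_fun phi x).
  move=> U s; apply: (germwise_section Hsh) => y Uy.
  have [V0 [V0y V0P]] := vanishing_near y hXl (@coh_coherent X H).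
  have [V1 [V1y [t tE]]] := mgerm_surj (psh_fun phi y (mgerm Uy s)).
  pose V := opensI V0 V1.
  exists V, (mres H (@opensIr _ V0 V1) t); split=> // z Uz [V0z V1z].
  rewrite (mgerm_res V1z).
  (* both germs at z agree at the common generizations x of y and z, where they come
     from equal germs at y *)
  apply/eqP; rewrite -subr_eq0; apply/eqP; apply: (V0P z V0z) => x xy xz.
  have xyl : (x <= y :> points X)%O by apply/asboolP.
  have xzl : (x <= z :> points X)%O by apply/asboolP.
  have Ux := generize xy Uy; have V1x := generize xy V1y.
  have := psh_nat phi xzl (mgerm Uz s); have := psh_nat phi xyl (mgerm Uy s).
  rewrite /= tE !(mstalk_genE _ V1y V1x) !(mstalk_genE _ Uy Ux) => e.
  rewrite !(mstalk_genE _ Uz Ux) -e => e'.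
  rewrite (Prop_irrelevance xz (le_closure xzl)) linearB /= (mstalk_genE _ V1z V1x).
  by apply/eqP; rewrite subr_eq0; apply/eqP.
exists psi; split=> [|chi chiE].
  by apply: psh_hom_ext => x v; exact: psiE.
apply: mhom_ext => U s; apply: (mgerm_ext Hsh) => x Ux.
have chix : mstalk_map chi (mgerm Ux s) = psh_fun phi x (mgerm Ux s).
  by rewrite -chiE.
by rewrite -!mstalk_mapE chix psiE.
Qed.
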